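(* Let $\mathbf x,\mathbf y\in\mathbb Z^2$ be primitive vectors with $\omega(\mathbf x,\mathbf y)=1$ (and $\delta(\mathbf x)>0$, $\delta(\mathbf y)>0$, so that the Baxter operators below are defined in the completion). Then $$Q_{\mathbf x}(v)\cdot Q_{\mathbf y}(w)=Q_{\mathbf y}(w)\cdot Q_{\mathbf x+\mathbf y}(vw)\cdot Q_{\mathbf x}(v)$$ in $\widehat{\mathcal A}\cong\widehat{\mathrm{Sk}}(T^2)$.
   Context: Let $R=\mathbb C[q^{\pm1/2},a^{\pm1},(q^{k/2}-q^{-k/2})^{-1}: k\ge 1]$, $s=q^{1/2}$, and $\{k\}=s^k-s^{-k}$. Let $\omega(\mathbf a,\mathbf b)=\det(\mathbf a|\mathbf b)$ on $\mathbb Z^2$. Let $\mathcal A$ be the associative unital $R$-algebra generated by elements $P_{\mathbf x}$, $\mathbf x\in\mathbb Z^2\setminus\{0\}$, with relations $[P_{\mathbf a},P_{\mathbf b}]=\{\omega(\mathbf a,\mathbf b)\}P_{\mathbf a+\mathbf b}$ (the right side is $0$ if $\mathbf a+\mathbf b=0$). By a theorem of Morton and Samuelson, $\mathcal A$ is isomorphic to the HOMFLYPT skein algebra $\mathrm{Sk}(T^2)$ of the closed torus. The algebra $\mathcal A$ is $\mathbb Z^2$-graded with $\deg P_{\mathbf x}=\mathbf x$. Fix a homomorphism $\delta:\mathbb Z^2\to\mathbb Z$. The completion is $\widehat{\mathcal A}=\varprojlim_n\bigoplus_{\delta(\lambda)\le n}\mathcal A_\lambda$, i.e. formal sums of homogeneous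 elements with only finitely many nonzero components of $\delta$-degree $\le n$, for every $n$; it is an algebra. For $\mathbf x\in\mathbb Z^2$ primitive with $\delta(\mathbf x)>0$ the Baxter operator is $$Q_{\mathbf x}(t)=\exp\Big(\sum_{n\ge1}\frac{-(-t)^n}{n\,(q^{n/2}-q^{-n/2})}P_{n\mathbf x}\Big)\in\widehat{\mathcal A}.$$ Here $t$ is a central parameter; $v,w$ are commuting central indeterminates (adjoined to $R$). *)

(* Defs.v *)
From HB Require Import structures.
From mathcomp Require Import all_boot all_order all_algebra.
From mathcomp Require Import generic_quotient ring_quotient.
From mathcomp Require Import finmap.
From mathcomp.multinomials Require Import monalg.
From mathcomp Require Import boolp classical_sets functions cardinality fsbigop.
From mathcomp Require Import reals complex zify.

Set Implicit Arguments.
Unset Strict Implicit.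
Unset Printing Implicit Defensive.

Import Order.TTheory GRing.Theory Num.Theory.

Local Open Scope ring_scope.
Local Open Scope quotient_scope.

Notation Z2 := (int * int)%type.

(* omega a b = det(a | b) *)
Definition omega (a b : Z2) : int := a.1 * b.2 - a.2 * b.1.

Definition primitive (x : Z2) : bool := coprimez x.1 x.2.

Section MalgComplements.
Variables (S : comNzRingType) (K : monomType).
Implicit Types u v w : {malg S[K]}.

Lemma malg_scaleAr (c : S) u v : c *: (u * v) = u * (c *: v).
Proof.
apply/malgP => k; rewrite mcoeffZ mcoeffMl.
rewrite (mcoeffMlw _ (fsubset_refl _) (msuppZ_le c v)) mulr_sumr.
apply: eq_bigr => k1 _; rewrite mulr_sumr; apply: eq_bigr => k2 _.
by rewrite mcoeffZ mulrnAr mulrCA.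
Qed.

Lemma mcoeff1M u v : (u * v)@_mone = u@_mone * v@_mone.
Proof. exact: (rmorphM (mcoeff mone)). Qed.

Lemma mcoeff1_commB u v w c : u@_mone = 0 -> v@_mone = 0 -> w@_mone = 0 ->
  (u * v - v * u - c *: w)@_mone = 0.
Proof.
by move=> u0 v0 w0; rewrite !mcoeffB mcoeffZ !mcoeff1M u0 v0 w0 !mulr0 !subr0.
Qed.

End MalgComplements.

(* The unital associative S-algebra generated by P_x, x in Z^2 \ {0}, with
   relations [P_a, P_b] = {omega(a, b)} P_(a+b), where {k} is [br k]: the free
   algebra modulo the two-sided ideal generated by the relators. *)
Section Presentation.
Variables (S : comNzRingType) (br : int -> S).

Definition lattice_gen := {x : Z2 | x != 0}.
Definition freeAlg := {malg S[{fmonom lattice_gen}]}.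

(* freeP 0 = 0, so that the relation for a + b = 0 reads [P_a, P_(-a)] = 0. *)
Definition freeP (x : Z2) : freeAlg :=
  if insub x is Some g then << fmu g >> else 0.

Inductive in_rel : freeAlg -> Prop :=
| in_rel_gen (a b : Z2) : a != 0 -> b != 0 ->
    in_rel (freeP a * freeP b - freeP b * freeP a
            - br (omega a b) *: freeP (a + b))
| in_rel_0 : in_rel 0
| in_rel_D u v : in_rel u -> in_rel v -> in_rel (u + v)
| in_rel_Ml u v : in_rel v -> in_rel (u * v)
| in_rel_Mr u v : in_rel u -> in_rel (u * v).

Definition rel_ideal : {pred freeAlg} := fun u => `[< in_rel u >].

Fact rel_ideal_zmod_closed : zmod_closed rel_ideal.
Proof.
split; first by apply/asboolP; exact: in_rel_0.
move=> u v /asboolP hu /asboolP hv; apply/asboolP.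
by apply: in_rel_D => //; rewrite -mulN1r; exact: in_rel_Ml.
Qed.

HB.instance Definition _ := GRing.isZmodClosed.Build freeAlg rel_ideal
  rel_ideal_zmod_closed.

Definition PAlg : Type := Quotient.quot rel_ideal.
HB.instance Definition _ := GRing.Zmodule.on PAlg.

Definition PAlg_pi (u : freeAlg) : PAlg := \pi_(Quotient.quot rel_ideal) u.

Lemma PAlg_piP u v : PAlg_pi u = PAlg_pi v <-> in_rel (u - v).
Proof.
split=> [/eqP|h]; first by rewrite -Quotient.idealrBE => /asboolP.
by apply/eqP; rewrite -Quotient.idealrBE; apply/asboolP.
Qed.

Lemma PAlg_piD : {morph PAlg_pi : u v / u + v}.
Proof. by move=> u v; rewrite /PAlg_pi !piE. Qed.

Lemma PAlg_piB : {morph PAlg_pi : u v / u - v}.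
Proof. by move=> u v; rewrite /PAlg_pi !piE. Qed.

Lemma PAlg_piK (u : PAlg) : PAlg_pi (repr u) = u.
Proof. exact: reprK. Qed.

Lemma in_rel_repr u : in_rel (repr (PAlg_pi u) - u).
Proof. by apply/PAlg_piP; rewrite PAlg_piK. Qed.

Definition PAlg_one : PAlg := PAlg_pi 1.
Definition PAlg_mul (u v : PAlg) : PAlg := PAlg_pi (repr u * repr v).
Definition PAlg_scale (c : S) (u : PAlg) : PAlg := PAlg_pi (c *: repr u).

Lemma PAlg_piM u v : PAlg_pi (u * v) = PAlg_mul (PAlg_pi u) (PAlg_pi v).
Proof.
apply/esym/PAlg_piP; set u' := repr _; set v' := repr _.
rewrite (_ : _ - _ = u' * (v' - v) + (u' - u) * v).
  by apply: in_rel_D; [apply: in_rel_Ml|apply: in_rel_Mr]; apply: in_rel_repr.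
by rewrite mulrBr mulrBl addrA subrK.
Qed.

Lemma PAlg_piZ c u : PAlg_pi (c *: u) = PAlg_scale c (PAlg_pi u).
Proof.
apply/esym/PAlg_piP; rewrite -scalerBr -[X in c *: X]mul1r scalerAl.
by apply: in_rel_Ml; apply: in_rel_repr.
Qed.

Fact PAlg_mulA : associative PAlg_mul.
Proof.
move=> u v w; rewrite -[u]PAlg_piK -[v]PAlg_piK -[w]PAlg_piK.
by rewrite -!PAlg_piM mulrA.
Qed.

Fact PAlg_mul1 : left_id PAlg_one PAlg_mul.
Proof. by move=> u; rewrite -[u]PAlg_piK -PAlg_piM mul1r. Qed.

Fact PAlg_mulr1 : right_id PAlg_one PAlg_mul.
Proof. by move=> u; rewrite -[u]PAlg_piK -PAlg_piM mulr1. Qed.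

Fact PAlg_mulDl : left_distributive PAlg_mul +%R.
Proof.
move=> u v w; rewrite -[u]PAlg_piK -[v]PAlg_piK -[w]PAlg_piK.
by rewrite -PAlg_piD -!PAlg_piM -PAlg_piD mulrDl.
Qed.

Fact PAlg_mulDr : right_distributive PAlg_mul +%R.
Proof.
move=> u v w; rewrite -[u]PAlg_piK -[v]PAlg_piK -[w]PAlg_piK.
by rewrite -PAlg_piD -!PAlg_piM -PAlg_piD mulrDr.
Qed.

Lemma freeP_mcoeff1 x : (freeP x)@_(mone : {fmonom lattice_gen}) = 0.
Proof.
rewrite /freeP; case: insubP => [g _ _|_]; last exact: mcoeff0.
by rewrite mcoeffU1 -fdeg_eq0 fdegU.
Qed.

Lemma in_rel_mcoeff1 u : in_rel u -> u@_(mone : {fmonom lattice_gen}) = 0.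
Proof.
elim=> {u} [a b _ _||u v _ hu _ hv|u v _ hv|u v _ hu].
- by apply: mcoeff1_commB; exact: freeP_mcoeff1.
- exact: mcoeff0.
- by rewrite mcoeffD hu hv addr0.
- by rewrite mcoeff1M hv mulr0.
- by rewrite mcoeff1M hu mul0r.
Qed.

Fact PAlg_oner_neq0 : PAlg_one != 0.
Proof.
apply/eqP => h.
have /PAlg_piP/in_rel_mcoeff1 : PAlg_pi 1 = PAlg_pi 0.
  by rewrite -/PAlg_one h; apply: (addrI (PAlg_pi 0)); rewrite -PAlg_piD !addr0.
by rewrite subr0 rmorph1 => /eqP; rewrite oner_eq0.
Qed.

HB.instance Definition _ := GRing.Zmodule_isNzRing.Build PAlg
  PAlg_mulA PAlg_mul1 PAlg_mulr1 PAlg_mulDl PAlg_mulDr PAlg_oner_neq0.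

Fact PAlg_scaleA a b u : PAlg_scale a (PAlg_scale b u) = PAlg_scale (a * b) u.
Proof. by rewrite -[u]PAlg_piK -!PAlg_piZ scalerA. Qed.

Fact PAlg_scale1 : left_id 1 PAlg_scale.
Proof. by move=> u; rewrite -[u]PAlg_piK -PAlg_piZ scale1r. Qed.

Fact PAlg_scaleDr : right_distributive PAlg_scale +%R.
Proof.
move=> c u v; rewrite -[u]PAlg_piK -[v]PAlg_piK.
by rewrite -PAlg_piD -!PAlg_piZ -PAlg_piD scalerDr.
Qed.

Fact PAlg_scaleDl u : {morph PAlg_scale^~ u : a b / a + b}.
Proof.
by move=> a b; rewrite -[u]PAlg_piK -!PAlg_piZ -PAlg_piD scalerDl.
Qed.

HB.instance Definition _ := GRing.Zmodule_isLmodule.Build S PAlg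
  PAlg_scaleA PAlg_scale1 PAlg_scaleDr PAlg_scaleDl.

Fact PAlg_scaleAl (c : S) (u v : PAlg) : c *: (u * v) = c *: u * v.
Proof.
rewrite -[u]PAlg_piK -[v]PAlg_piK.
by rewrite -[_ * _]PAlg_piM -[LHS]PAlg_piZ -[c *: _]PAlg_piZ
           -[RHS]PAlg_piM scalerAl.
Qed.

HB.instance Definition _ := GRing.LSemiModule_isLSemiAlgebra.Build S PAlg
  PAlg_scaleAl.

Fact PAlg_scaleAr (c : S) (u v : PAlg) : c *: (u * v) = u * (c *: v).
Proof.
rewrite -[u]PAlg_piK -[v]PAlg_piK.
by rewrite -[_ * _]PAlg_piM -[LHS]PAlg_piZ -[c *: _]PAlg_piZ
           -[RHS]PAlg_piM malg_scaleAr.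
Qed.

HB.instance Definition _ := GRing.LSemiAlgebra_isSemiAlgebra.Build S PAlg
  PAlg_scaleAr.

Definition genP (x : Z2) : PAlg := PAlg_pi (freeP x).

Lemma genP_comm (a b : Z2) : a != 0 -> b != 0 ->
  genP a * genP b - genP b * genP a = br (omega a b) *: genP (a + b).
Proof.
move=> a0 b0; rewrite -[genP a * _]PAlg_piM -[genP b * _]PAlg_piM -PAlg_piB.
rewrite -[RHS]PAlg_piZ; apply/PAlg_piP.
exact: in_rel_gen.
Qed.

(* The Z^2-grading with deg P_x = x: [homog l] is the submodule of elements of
   degree l, i.e. the span of the products P_(x_1) .. P_(x_k) with
   x_1 + .. + x_k = l. *)
Inductive homog : Z2 -> PAlg -> Prop :=
| homog_0 l : homog l 0
| homog_D l u v : homog l u -> homog l v -> homog l (u + v)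
| homog_Z l c u : homog l u -> homog l (c *: u)
| homog_1 : homog 0 1
| homog_P x : homog x (genP x)
| homog_M l m u v : homog l u -> homog m v -> homog (l + m) (u * v).

End Presentation.

Section FiniteSums.
Variables (I : choiceType) (V : zmodType).
Implicit Types F G : I -> V.

Lemma fsumTE F (D : set I) : finite_set D ->
    (forall i, F i != 0 -> D i) ->
  \sum_(i \in [set: I]) F i = \sum_(i <- fset_set D) F i.
Proof.
move=> Dfin FD; apply: fsbigTE => i; rewrite in_fset_set //.
by apply: contraNeq => /FD Di; rewrite inE.
Qed.

Lemma fsum_neq0 F (D : set I) :
  \sum_(i \in D) F i != 0 -> exists i, F i != 0.
Proof.
move=> sF; apply: contrapT => /forallNP F0; move/eqP: sF; apply.
by apply: fsbig1 => i _; apply/eqP; apply: contrapT => /negP; exact: F0.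
Qed.

Lemma fsumTD F G : finite_set [set i | F i != 0] ->
    finite_set [set i | G i != 0] ->
  \sum_(i \in [set: I]) (F i + G i) =
  \sum_(i \in [set: I]) F i + \sum_(i \in [set: I]) G i.
Proof.
move=> Ff Gf.
have UF : finite_set ([set i | F i != 0] `|` [set i | G i != 0])%classic.
  by rewrite finite_setU.
rewrite (fsumTE UF); last first.
  move=> i /=; case: (eqVneq (F i) 0) => [->|]; last by left.
  by rewrite add0r; right.
rewrite big_split /= -(fsumTE UF) -?(fsumTE UF) //.
- by move=> i Gi; right.
- by move=> i Fi; left.
Qed.

Lemma fsumT_single F (j : I) : (forall i, i != j -> F i = 0) ->
  \sum_(i \in [set: I]) F i = F j.
Proof.
move=> F0; rewrite (fsumTE (finite_set1 j)) ?fset_set1 ?big_seq_fset1 // => i.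
by apply: contra_neqP => /eqP/F0.
Qed.

End FiniteSums.

Section FiniteSumsAlgebra.
Variables (I : choiceType) (S : comNzRingType) (A : algType S) (F : I -> A).
Hypothesis Ffin : finite_set [set i | F i != 0].

Lemma fsumT_mull c :
  c * (\sum_(i \in [set: I]) F i) = \sum_(i \in [set: I]) c * F i.
Proof.
rewrite (fsumTE Ffin) // mulr_sumr; apply/esym/(fsumTE Ffin) => i.
by apply: contra_neq => ->; rewrite mulr0.
Qed.

Lemma fsumT_mulr c :
  (\sum_(i \in [set: I]) F i) * c = \sum_(i \in [set: I]) F i * c.
Proof.
rewrite (fsumTE Ffin) // mulr_suml; apply/esym/(fsumTE Ffin) => i.
by apply: contra_neq => ->; rewrite mul0r.
Qed.

Lemma fsumT_scale (c : S) :
  c *: (\sum_(i \in [set: I]) F i) = \sum_(i \in [set: I]) c *: F i.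
Proof.
rewrite (fsumTE Ffin) // scaler_sumr; apply/esym/(fsumTE Ffin) => i.
by apply: contra_neq => ->; rewrite scaler0.
Qed.

End FiniteSumsAlgebra.

Lemma fsumT_exchange (I J : choiceType) (V : zmodType) (T : I -> J -> V) :
    finite_set [set p : I * J | T p.1 p.2 != 0] ->
  \sum_(i \in [set: I]) \sum_(j \in [set: J]) T i j =
  \sum_(j \in [set: J]) \sum_(i \in [set: I]) T i j.
Proof.
move=> Df; set D := (X in finite_set X) in Df.
have D1 : finite_set (fst @` D)%classic by apply: finite_image.
have D2 : finite_set (snd @` D)%classic by apply: finite_image.
have T1 i j : T i j != 0 -> (fst @` D)%classic i by exists (i, j).
have T2 i j : T i j != 0 -> (snd @` D)%classic j by exists (i, j).
rewrite (fsumTE D1) => [|i hi]; last by case: (fsum_neq0 hi) => j; exact: T1.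
rewrite (fsumTE D2) => [|j hj]; last by case: (fsum_neq0 hj) => i; exact: T2.
transitivity (\sum_(i <- fset_set (fst @` D)%classic)
              \sum_(j <- fset_set (snd @` D)%classic) T i j).
  by apply: eq_bigr => i _; apply: fsumTE D2 _ => j; exact: T2.
rewrite exchange_big; apply: eq_bigr => j _.
by apply/esym/(fsumTE D1) => i; exact: T1.
Qed.

(* The completion lim_n (+)_(delta l <= n) A_l, as the algebra of families of
   homogeneous elements with only finitely many nonzero components of
   delta-degree <= n for every n, under convolution. *)
Section Completion.
Variables (S : comNzRingType) (br : int -> S) (delta : {additive Z2 -> int}).

Local Notation A := (PAlg br).
Implicit Types (f g h : Z2 -> A) (l m : Z2).

Definition in_hat f : Prop :=
  (forall l, homog l (f l)) /\
  (forall n : int, finite_set [set l | delta l <= n /\ f l != 0]).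

Record Ahat : Type := Hat { hat_comp :> Z2 -> A; hat_compP : in_hat hat_comp }.

HB.instance Definition _ := gen_eqMixin Ahat.
HB.instance Definition _ := gen_choiceMixin Ahat.

Lemma hatP (f g : Ahat) : (forall l, f l = g l) <-> f = g.
Proof.
split=> [fg|-> //]; case: f g fg => [f hf] [g hg] /= /funext fg.
by case: g / fg hg => hg; congr Hat; apply: Prop_irrelevance.
Qed.

Lemma homog_fsum (I : choiceType) (D : set I) (F : I -> A) l :
  (forall i, homog l (F i)) -> homog l (\sum_(i \in D) F i).
Proof.
move=> hF; apply: (big_ind (homog l)) => [|u v|i _]; first exact: homog_0.
- exact: homog_D.
- exact: hF.
Qed.

Lemma in_hat_lb f : in_hat f -> exists b : int, forall l, f l != 0 -> b <= delta l.
Proof.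
move=> [_ /(_ 0) fin]; pose D := fset_set [set l | delta l <= 0 /\ f l != 0].
exists (- \sum_(l <- D) `|delta l|) => l fl.
have [dl|dl] := leP (delta l) 0; last first.
  by apply: le_trans (ltW dl); rewrite oppr_le0 sumr_ge0.
have lD : l \in D by rewrite in_fset_set // inE.
rewrite lerNl (big_rem l) //= ler_wpDr ?sumr_ge0 //.
by rewrite -normrN ler_norm.
Qed.

Fact zero_in_hat : in_hat (fun=> 0).
Proof.
split=> [l|n]; first exact: homog_0.
by apply: (sub_finite_set _ (finite_set0 _)) => l /= [_]; rewrite eqxx.
Qed.

Fact add_in_hat f g : in_hat f -> in_hat g -> in_hat (fun l => f l + g l).
Proof.
move=> [hf ff] [hg fg]; split=> [l|n]; first exact: homog_D.
apply: (@sub_finite_set _ _ ([set l | delta l <= n /\ f l != 0] `|`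
                           [set l | delta l <= n /\ g l != 0])%classic).
  move=> l /= [ln]; case: (eqVneq (f l) 0) => [->|]; last by left.
  by rewrite add0r; right.
by rewrite finite_setU; split; [exact: ff|exact: fg].
Qed.

Fact scale_in_hat c f : in_hat f -> in_hat (fun l => c *: f l).
Proof.
move=> [hf ff]; split=> [l|n]; first exact: homog_Z.
refine (sub_finite_set _ (ff n)).
move=> l [ln cf]; split; first exact: ln.
by apply: contra_neq cf => ->; rewrite scaler0.
Qed.

Definition conv f g l : A := \sum_(m \in [set: Z2]) f m * g (l - m).

Lemma conv_neq0 f g l : conv f g l != 0 ->
  exists2 m, f m != 0 & g (l - m) != 0.
Proof.
move=> /fsum_neq0[m fg]; exists m; apply: contra_neq fg => ->.
  by rewrite mul0r.
by rewrite mulr0.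
Qed.

Lemma conv_fin f g l : in_hat f -> in_hat g ->
  finite_set [set m | f m * g (l - m) != 0].
Proof.
move=> hf /in_hat_lb[b gb]; apply: sub_finite_set _ (hf.2 (delta l - b)) => m /= fg.
have : f m != 0 by apply: contra_neq fg => ->; rewrite mul0r.
split=> //; rewrite lerBrDr -lerBrDl -raddfB; apply: gb.
by apply: contra_neq fg => ->; rewrite mulr0.
Qed.

Fact conv_in_hat f g : in_hat f -> in_hat g -> in_hat (conv f g).
Proof.
move=> hf hg; split=> [l|n].
  apply: homog_fsum => m; rewrite -[X in homog X](subrKC m).
  by apply: homog_M; [apply: hf.1|apply: hg.1].
have [bf hbf] := in_hat_lb hf; have [bg hbg] := in_hat_lb hg.
have fin := finite_setX (hf.2 (n - bg)) (hg.2 (n - bf)).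
apply: sub_finite_set _ (finite_image (fun p => p.1 + p.2) fin).
move=> l /= [ln /conv_neq0[m fm glm]].
exists (m, l - m) => /=; last by rewrite subrKC.
have dl : delta m + delta (l - m) <= n by rewrite -raddfD subrKC.
have := hbf _ fm; have := hbg _ glm => h1 h2.
split; split=> //; rewrite lerBrDr; apply: le_trans dl.
  by rewrite lerD2l.
by rewrite addrC lerD2r.
Qed.

Definition hzero := Hat zero_in_hat.
Definition hadd (f g : Ahat) := Hat (add_in_hat (hat_compP f) (hat_compP g)).
Definition hscale c (f : Ahat) := Hat (scale_in_hat c (hat_compP f)).
Definition hopp (f : Ahat) := hscale (-1) f.
Definition hmul (f g : Ahat) := Hat (conv_in_hat (hat_compP f) (hat_compP g)).

Fact single_in_hat l (u : A) : homog l u ->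
  in_hat (fun m => if m == l then u else 0).
Proof.
move=> hu; split=> [m|n]; first by case: eqP => [->|_] //; exact: homog_0.
apply: sub_finite_set _ (finite_set1 l) => m /= [_].
by case: (eqVneq m l) => [->|] //; rewrite eqxx.
Qed.

Definition hsingle l (u : A) (hu : homog l u) := Hat (single_in_hat hu).

Definition hone := hsingle (homog_1 br).

Fact haddA : associative hadd.
Proof. by move=> f g h; apply/hatP => l /=; rewrite addrA. Qed.
Fact haddC : commutative hadd.
Proof. by move=> f g; apply/hatP => l /=; rewrite addrC. Qed.
Fact hadd0 : left_id hzero hadd.
Proof. by move=> f; apply/hatP => l /=; rewrite add0r. Qed.
Fact haddN : left_inverse hzero hopp hadd.
Proof. by move=> f; apply/hatP => l /=; rewrite scaleN1r addNr. Qed.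

HB.instance Definition _ := GRing.isZmodule.Build Ahat haddA haddC hadd0 haddN.

Lemma hmul_triple_fin (f g h : Ahat) l :
  finite_set [set p : Z2 * Z2 | f p.1 * g (p.2 - p.1) * h (l - p.2) != 0].
Proof.
have [bf hbf] := in_hat_lb (hat_compP f).
have [bg hbg] := in_hat_lb (hat_compP g).
have [bh hbh] := in_hat_lb (hat_compP h).
have fin := finite_setX ((hat_compP f).2 (delta l - bg - bh))
                        ((hat_compP h).2 (delta l - bf - bg)).
apply: sub_finite_set _ (finite_image (fun p => (p.1, l - p.2)) fin).
move=> [k m] /= T.
have fk : f k != 0 by apply: contra_neq T => ->; rewrite !mul0r.
have gk : g (m - k) != 0 by apply: contra_neq T => ->; rewrite mulr0 mul0r.
have hk : h (l - m) != 0 by apply: contra_neq T => ->; rewrite mulr0.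
exists (k, l - m) => /=; last by rewrite subKr.
have hm := hbh _ hk; have gm := hbg _ gk; have fm := hbf _ fk.
have aux (a b c x y z : int) : x <= a -> y <= b -> z <= c ->
  a <= a + b + c - y - z /\ c <= a + b + c - x - y by lia.
have := aux _ _ _ _ _ _ fm gm hm.
rewrite (_ : delta k + _ + _ = delta l); first by case=> *; do !split.
by rewrite -!raddfD !subrKC.
Qed.

Fact hmulA : associative hmul.
Proof.
move=> f g h; apply/hatP => l /=; rewrite /conv /=.
transitivity (\sum_(k \in [set: Z2]) \sum_(m \in [set: Z2])
                (f k * g (m - k) * h (l - m))); last first.
  rewrite fsumT_exchange; last exact: hmul_triple_fin.
  apply: eq_fsbigr => m _.
  by apply/esym; apply: fsumT_mulr; apply: conv_fin; apply: hat_compP.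
apply: eq_fsbigr => k _.
rewrite fsumT_mull; last by apply: conv_fin; apply: hat_compP.
have bij : bijective (fun m : Z2 => m - k).
  by exists (fun m => m + k) => m; rewrite ?subrK ?addrK.
apply: etrans (reindex_fsbigT _ (fun m => f k * (g m * h (l - k - m))) bij) _.
apply: eq_fsbigr => m _ /=; rewrite mulrA; congr (_ * h _).
by rewrite opprB addrA subrK.
Qed.

Fact hmul1 : left_id hone hmul.
Proof.
move=> f; apply/hatP => l /=; rewrite /conv /= (fsumT_single (j := 0)) => [|m].
  by rewrite eqxx mul1r subr0.
by move=> /negbTE->; rewrite mul0r.
Qed.

Fact hmulr1 : right_id hone hmul.
Proof.
move=> f; apply/hatP => l /=; rewrite /conv /= (fsumT_single (j := l)) => [|m].
  by rewrite subrr eqxx mulr1.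
by rewrite eq_sym -subr_eq0 => /negbTE->; rewrite mulr0.
Qed.

Fact hmulDl : left_distributive hmul +%R.
Proof.
move=> f g h; apply/hatP => l; rewrite /= /conv.
transitivity (\sum_(m \in [set: Z2]) (f m * h (l - m) + g m * h (l - m))).
  by apply: eq_fsbigr => m _; exact: mulrDl.
by apply: fsumTD; apply: conv_fin; apply: hat_compP.
Qed.

Fact hmulDr : right_distributive hmul +%R.
Proof.
move=> f g h; apply/hatP => l; rewrite /= /conv.
transitivity (\sum_(m \in [set: Z2]) (f m * g (l - m) + f m * h (l - m))).
  by apply: eq_fsbigr => m _; exact: mulrDr.
by apply: fsumTD; apply: conv_fin; apply: hat_compP.
Qed.

Fact hone_neq0 : hone != 0.
Proof.
apply/eqP => h0; have : hone 0 = hzero 0 by rewrite h0.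
by move=> /= /eqP; rewrite oner_eq0.
Qed.

HB.instance Definition _ := GRing.Zmodule_isNzRing.Build Ahat
  hmulA hmul1 hmulr1 hmulDl hmulDr hone_neq0.

Fact hscaleA a b (f : Ahat) : hscale a (hscale b f) = hscale (a * b) f.
Proof. by apply/hatP => l /=; rewrite scalerA. Qed.
Fact hscale1 : left_id 1 hscale.
Proof. by move=> f; apply/hatP => l /=; rewrite scale1r. Qed.
Fact hscaleDr : right_distributive hscale +%R.
Proof. by move=> c f g; apply/hatP => l /=; rewrite scalerDr. Qed.
Fact hscaleDl (f : Ahat) : {morph hscale^~ f : a b / a + b}.
Proof. by move=> a b; apply/hatP => l /=; rewrite scalerDl. Qed.

HB.instance Definition _ := GRing.Zmodule_isLmodule.Build S Ahat
  hscaleA hscale1 hscaleDr hscaleDl.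

Fact hscaleAl (c : S) (f g : Ahat) : c *: (f * g) = c *: f * g.
Proof.
apply/hatP => l /=; rewrite /conv /=.
rewrite fsumT_scale; last by apply: conv_fin; apply: hat_compP.
by apply: eq_fsbigr => m _; rewrite scalerAl.
Qed.

HB.instance Definition _ := GRing.LSemiModule_isLSemiAlgebra.Build S Ahat
  hscaleAl.

Fact hscaleAr (c : S) (f g : Ahat) : c *: (f * g) = f * (c *: g).
Proof.
apply/hatP => l /=; rewrite /conv /=.
rewrite fsumT_scale; last by apply: conv_fin; apply: hat_compP.
by apply: eq_fsbigr => m _; rewrite scalerAr.
Qed.

HB.instance Definition _ := GRing.LSemiAlgebra_isSemiAlgebra.Build S Ahat
  hscaleAr.

Definition hP (x : Z2) : Ahat := hsingle (homog_P br x).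

(* Sequences of elements of the completion whose sum converges there; the sum
   is then computed componentwise, with finitely many nonzero terms. *)
Definition summable (u : nat -> Ahat) : Prop :=
  forall n : int,
    finite_set [set p : nat * Z2 | delta p.2 <= n /\ u p.1 p.2 != 0].

Fact hsum_in_hat (u : nat -> Ahat) : summable u ->
  in_hat (fun l => \sum_(k \in [set: nat]) u k l).
Proof.
move=> su; split=> [l|n]; first by apply: homog_fsum => k; apply: (hat_compP _).1.
apply: sub_finite_set _ (finite_image snd (su n)) => l /= [ln].
by move=> /fsum_neq0[k ukl]; exists (k, l).
Qed.

Definition hsum (u : nat -> Ahat) (su : summable u) : Ahat :=
  Hat (hsum_in_hat su).

Definition pos_degree (X : Ahat) : Prop := forall l, X l != 0 -> 0 < delta l.

Lemma positive_exp_deg (X : Ahat) n l : pos_degree X ->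
  (X ^+ n) l != 0 -> n%:Z <= delta l.
Proof.
move=> pX; elim: n l => [|n IHn] l.
  rewrite expr0 /=; have [->|_] := eqVneq l 0; last by rewrite eqxx.
  by move=> _; rewrite (raddf0 delta).
rewrite exprS => /conv_neq0[m /pX dm /IHn].
have aux (a b : int) : 0 < a -> n%:Z <= b - a -> n.+1%:Z <= b by lia.
by rewrite (raddfB delta); exact: aux.
Qed.

Lemma summable_powers (c : nat -> S) (X : Ahat) : pos_degree X ->
  summable (fun n => c n *: X ^+ n).
Proof.
move=> pX n.
have fin k : finite_set ((pair k) @` [set l | delta l <= n /\ (X ^+ k) l != 0])%classic.
  by apply: finite_image; apply: (hat_compP _).2.
apply: (@sub_finite_set _ _ (\bigcup_(k in [set k | (k < `|n|.+1)%N])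
  ((pair k) @` [set l | delta l <= n /\ (X ^+ k) l != 0]))%classic).
  move=> [k l] /= [ln ckl].
  have Xkl : (X ^+ k) l != 0 by apply: contra_neq ckl => ->; rewrite scaler0.
  have := positive_exp_deg pX Xkl => kl.
  exists k => /=; first by lia.
  by exists l.
by apply: bigcup_finite => // k _; exact: fin.
Qed.

Lemma summable_multiples (c : nat -> S) (x : Z2) : 0 < delta x ->
  summable (fun n => c n.+1 *: hP (x *+ n.+1)).
Proof.
move=> dx n.
apply: (@sub_finite_set _ _ ((fun k => (k, x *+ k.+1)) @`
  [set k | (k < `|n|.+1)%N])%classic); last exact/finite_image/finite_II.
move=> [k l] /= [ln]; have [lx _|_] := eqVneq l (x *+ k.+1); last by rewrite scaler0 eqxx.
move: ln; rewrite lx; rewrite (raddfMn delta) -mulr_natr natz => ln.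
exists k => /=; last by [].
have aux (d : int) : 0 < d -> d * k.+1%:Z <= n -> (k < `|n|.+1)%N by nia.
exact: aux dx ln.
Qed.

Lemma positive_multiples (c : nat -> S) (x : Z2) (dx : 0 < delta x) :
  pos_degree (hsum (summable_multiples c dx)).
Proof.
move=> l /= /fsum_neq0[k] /=; have [-> _|_] := eqVneq l (x *+ k.+1); last by rewrite scaler0 eqxx.
by rewrite raddfMn pmulrn_rgt0.
Qed.

Lemma delta_gt0D (x y : Z2) : 0 < delta x -> 0 < delta y -> 0 < delta (x + y).
Proof. by move=> dx dy; rewrite raddfD addr_gt0. Qed.

End Completion.

Lemma brV0 (K : fieldType) (x : K) : (x ^ 0 - x ^ (- 0))^-1 = 1 + - 1.
Proof. by rewrite oppr0 !subrr invr0. Qed.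

Section Scalars.
Variable Rr : realType.

Local Notation C := (complex Rr).

(* The field C(s, a): s is the inner variable, a the outer one. *)
Definition Ksa : fieldType := {fraction {poly {poly C}}}.
Definition Kcst (c : C) : Ksa := tofrac c%:P%:P.
Definition Ks : Ksa := tofrac 'X%:P.
Definition Ka : Ksa := tofrac 'X.
Definition Kbr (k : int) : Ksa := Ks ^ k - Ks ^ (- k).

Inductive in_base : Ksa -> Prop :=
| in_base_cst c : in_base (Kcst c)
| in_base_s : in_base Ks
| in_base_sV : in_base Ks^-1
| in_base_a : in_base Ka
| in_base_aV : in_base Ka^-1
| in_base_brV (k : nat) : (0 < k)%N -> in_base (Kbr k)^-1
| in_base_D x y : in_base x -> in_base y -> in_base (x + y)
| in_base_N x : in_base x -> in_base (- x)
| in_base_M x y : in_base x -> in_base y -> in_base (x * y).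

Definition base_pred : {pred Ksa} := fun x => `[< in_base x >].

Fact in_base_1 : in_base 1.
Proof. by have := in_base_cst 1; rewrite /Kcst !rmorph1. Qed.

Fact base_subring_closed : subring_closed base_pred.
Proof.
split=> [|x y /asboolP hx /asboolP hy|x y /asboolP hx /asboolP hy].
- by apply/asboolP; exact: in_base_1.
- by apply/asboolP; apply: in_base_D => //; exact: in_base_N.
- by apply/asboolP; exact: in_base_M.
Qed.

HB.instance Definition _ := GRing.isSubringClosed.Build Ksa base_pred
  base_subring_closed.

(* R = C[s^(+-1), a^(+-1), {k}^(-1) : k >= 1], with s = q^(1/2) *)
Definition baseR : Type := {x : Ksa | base_pred x}.
HB.instance Definition _ := [isSub for (@sval _ _ : baseR -> Ksa)].
HB.instance Definition _ := [Choice of baseR by <:].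
HB.instance Definition _ := [SubChoice_isSubComNzRing of baseR by <:].

Lemma in_base_X x (n : nat) : in_base x -> in_base (x ^+ n).
Proof.
move=> hx; elim: n => [|n IHn]; first by rewrite expr0; exact: in_base_1.
by rewrite exprS; exact: in_base_M.
Qed.

Fact Kbr_in_base (k : int) : base_pred (Kbr k).
Proof.
have hs (m : int) : in_base (Ks ^ m).
  case: m => n; first by apply: in_base_X; exact: in_base_s.
  by rewrite NegzE -exprnN -exprVn; apply: in_base_X; exact: in_base_sV.
by apply/asboolP; apply: in_base_D => //; exact: in_base_N.
Qed.

Fact KbrV_in_base (k : nat) : base_pred (Kbr k)^-1.
Proof.
apply/asboolP; case: k => [|k]; last exact: in_base_brV.
rewrite (_ : (Kbr 0)^-1 = 1 + - 1); last exact: brV0.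
by apply: in_base_D; [|apply: in_base_N]; exact: in_base_1.
Qed.

Fact Kcst_in_base (c : C) : base_pred (Kcst c).
Proof. by apply/asboolP; exact: in_base_cst. Qed.

(* R[v, w]: v is the inner variable, w the outer one. *)
Definition scal : comNzRingType := {poly {poly baseR}}.
Definition vind : scal := 'X%:P.
Definition wind : scal := 'X.

Definition of_base (x : baseR) : scal := x%:P%:P.

(* {k}, its inverse for k >= 1, and the complex constants, in R[v, w] *)
Definition brk (k : int) : scal := of_base (exist _ (Kbr k) (Kbr_in_base k)).
Definition brkV (k : nat) : scal := of_base (exist _ (Kbr k)^-1 (KbrV_in_base k)).
Definition scal_cst (c : C) : scal := of_base (exist _ (Kcst c) (Kcst_in_base c)).

Variable delta : {additive Z2 -> int}.

Definition skeinHat := Ahat brk delta.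

(* exp X = sum_n X^n / n!, for X with all components of positive degree *)
Definition hexp (X : skeinHat) (pX : pos_degree X) : skeinHat :=
  hsum (summable_powers (fun n => scal_cst (n`!%:R^-1)) pX).

Definition Baxter_coef (t : scal) (n : nat) : scal :=
  - (- t) ^+ n * scal_cst (n%:R^-1) * brkV n.

(* The sum over n >= 1 of -(-t)^n / (n {n}) P_(n x); the index is shifted in
   [summable_multiples]. *)
Definition Baxter_log (x : Z2) (dx : 0 < delta x) (t : scal) : skeinHat :=
  hsum (summable_multiples brk (Baxter_coef t) dx).

Fact Baxter_log_positive (x : Z2) (dx : 0 < delta x) (t : scal) :
  pos_degree (Baxter_log dx t).
Proof. exact: positive_multiples. Qed.

Definition Baxter (x : Z2) (dx : 0 < delta x) (t : scal) : skeinHat :=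
  hexp (@Baxter_log_positive x dx t).

End Scalars.

(* Main.v *)
Require Import Defs.
From HB Require Import structures.
From mathcomp Require Import all_boot all_order all_algebra.
From mathcomp Require Import finmap boolp classical_sets functions cardinality fsbigop.
From mathcomp Require Import reals complex zify ring.

(* For an additive phi : Z^2 -> Z, multiplying the component of degree l by
   phi l is a derivation E_phi of the completion, and it sends Q_u(t) to
   phi(u) L_u(t) Q_u(t), where L_u(t) is the logarithmic derivative of Q_u(t).
   An equation E_phi D = X D + D Y with X, Y of positive delta-degree has only
   the zero solution among the D supported on phi > 0.

   With phi = omega(x, -), this uniqueness reduces
     P_z Q_y(w) = Q_y(w) sum_k [n, k] w^k P_(z + k y),   n = omega(z, y),
   and its mirror image, for z proportional to x, to Newton's identity
   k [n, k] = sum_(1 <= j <= k) (-1)^(j-1) [n, k-j] {n j} / {j} for balanced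
   q-binomials (n may be negative).  Summing over the multiples of x gives
     L_x(v) Q_y(w) = Q_y(w) M  and  Q_(x+y)(vw) L_x(v) = N Q_(x+y)(vw)
   with M = L_(x+y)(vw) + N.  Hence, for phi = omega(-, y), both sides F of the
   pentagon identity satisfy E_phi F = L_x(v) F, and their difference is
   supported on phi > 0. *)

Set Implicit Arguments.
Unset Strict Implicit.
Unset Printing Implicit Defensive.

Import Order.TTheory GRing.Theory Num.Theory.
Local Open Scope ring_scope.

(** * Balanced q-binomial coefficients *)

Section QuantumBinomial.
Variables (S : comNzRingType) (sp br : int -> S) (brV : nat -> S).
Hypotheses (sp0 : sp 0 = 1) (spD : {morph sp : a b / a + b >-> a * b}).
Hypothesis brE : forall k, br k = sp k - sp (- k).
Hypothesis brVK : forall k : nat, brV k.+1 * br k.+1 = 1.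

(** The product {n} .. {n-k+1} / ({k} .. {1}), which makes sense for negative n as well. *)
Fixpoint qbin (n : int) (k : nat) : S :=
  if k is k'.+1 then qbin n k' * br (n - k'%:Z) * brV k'.+1 else 1.

Lemma qbinS n k : qbin n k.+1 = qbin n k * br (n - k%:Z) * brV k.+1.
Proof. by []. Qed.

Lemma br_odd k : br (- k) = - br k.
Proof. by rewrite !brE opprK opprB. Qed.

Lemma brD a b : br (a + b) = sp a * br b + sp (- b) * br a.
Proof. by rewrite !brE opprD !spD; ring. Qed.

Lemma qbinSS (n : int) (k : nat) :
  qbin (n + 1) k.+1 = qbin n k * br (n + 1) * brV k.+1.
Proof.
elim: k => [|k IHk]; first by rewrite /= subr0.
rewrite qbinS IHk qbinS.
have -> : n + 1 - k.+1%:Z = n - k%:Z by lia.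
by ring.
Qed.

(** Splitting {n+1} as {(k+1) + (n-k)} with [brD] gives the two terms; the one carrying {k+1}
    cancels [brV k.+1]. *)
Lemma qbin_pascal (n : int) (k : nat) :
  qbin (n + 1) k.+1 =
  sp k.+1%:Z * qbin n k.+1 + sp (k%:Z - n) * qbin n k.
Proof.
rewrite qbinSS qbinS.
have -> : n + 1 = k.+1%:Z + (n - k%:Z) by lia.
rewrite brD opprB.
set c := sp (k%:Z - n); have : brV k.+1 * br k.+1 = 1 by exact: brVK.
move: (brV _) (br _) => V B VB.
by rewrite -[c * _ in RHS]mulr1 -VB; ring.
Qed.

Lemma qbin_small (n k : nat) : (n < k)%N -> qbin n k = 0.
Proof.
elim: k => [//|k IHk] /=; rewrite ltnS leq_eqVlt => /orP[/eqP<-|/IHk->].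
  by rewrite subrr brE oppr0 subrr mulr0 mul0r.
by rewrite !mul0r.
Qed.

(** Up to sign the numerators of [qbin (- m%:Z) k] are {m} .. {m+k-1}, those of [qbin (m + k)%N k]
    are {m+1} .. {m+k}; the extreme factors make up the difference. *)
Lemma qbin_neg (m k : nat) :
  br m * qbin (m + k)%N k = (-1) ^+ k * br (m + k)%N * qbin (- m%:Z) k.
Proof.
elim: k => [|k IHk]; first by rewrite addn0 /= expr0 mulr1 mul1r mulr1.
have -> : (m + k.+1)%N%:Z = (m + k)%N%:Z + 1 by lia.
rewrite qbinSS qbinS !mulrA IHk exprS.
have -> : - m%:Z - k%:Z = - (m + k)%N%:Z by lia.
rewrite br_odd; ring.
Qed.

Lemma qbin_neg_brV (m k : nat) : brV (m.+1 + k) * qbin (m.+1 + k)%N k =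
  (-1) ^+ k * brV m.+1 * qbin (- m.+1%:Z) k.
Proof.
have := qbin_neg m.+1 k; have := brVK m; have := brVK (m + k).
rewrite -addSn; move: (qbin _ _) (qbin _ _) (brV _) (brV _) => p q B b.
move: (br _) (br _) (_ ^+ k) => C c e BC bc h.
by rewrite -[b * q]mul1r -bc mulrACA h -[RHS]mulr1 -BC; ring.
Qed.

Lemma qbin_nn (n : nat) : qbin n n = 1.
Proof.
elim: n => [//|n IHn]; rewrite -[in X in qbin X _]addn1 PoszD qbinSS IHn.
by rewrite mul1r mulrC -PoszD addn1 brVK.
Qed.

(* The (j+1)-st power sum {n (j+1)} / {j+1} of [s^(n-1), s^(n-3), .., s^(1-n)]. *)
Definition qpow (n : int) (j : nat) : S := br (n * j.+1%:Z) * brV j.+1.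

(** The variables for n+1 are s times those for n, together with s^(-n). *)
Lemma qpowS n j :
  qpow (n + 1) j = sp j.+1%:Z * qpow n j + sp (- (n * j.+1%:Z)).
Proof.
rewrite /qpow mulrDl mul1r addrC brD.
rewrite -[sp (- _) in RHS]mulr1 -(brVK j); ring.
Qed.

Definition newton_sum n k : S :=
  \sum_(j < k) (-1) ^+ j * qbin n (k.-1 - j) * qpow n j.

Lemma newton_sumS n k :
  newton_sum (n + 1) k.+1 =
  sp k.+1%:Z * newton_sum n k.+1
  + sp (k%:Z - n) * (newton_sum n k + qbin n k).
Proof.
(* [u j] and [u j.+1] are the two Pascal halves of [qbin (n + 1) (k - j)] times the contribution
   s^(-n(j+1)) of the new variable to [qpow (n + 1) j]; with alternating signs they telescope. *)
pose u (j : nat) := sp (k%:Z - j%:Z - n * j.+1%:Z) * qbin n (k - j).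
have tele m : \sum_(j < m) (-1) ^+ j * (u j + u j.+1) = u 0 - (-1) ^+ m * u m.
  elim: m => [|m IHm]; first by rewrite big_ord0 expr0 mul1r subrr.
  by rewrite big_ord_recr /= IHm exprS; ring.
rewrite /newton_sum big_ord_recr [\sum_(j < k.+1) _ in RHS]big_ord_recr /=.
rewrite !subnn /=.
have -> : \sum_(j < k) (-1) ^+ j * qbin (n + 1) (k - j) * qpow (n + 1) j =
    \sum_(j < k) (sp k.+1%:Z * ((-1) ^+ j * qbin n (k - j) * qpow n j)
     + sp (k%:Z - n) * ((-1) ^+ j * qbin n (k.-1 - j) * qpow n j)
     + (-1) ^+ j * (u j + u j.+1)).
  apply: eq_bigr => j _; rewrite /u.
  have -> : (k - j.+1 = k.-1 - j)%N by lia.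
  have -> : (k - j = (k.-1 - j).+1)%N by have := ltn_ord j; lia.
  set i := (k.-1 - j)%N; have ->: k%:Z = i.+1%:Z + j%:Z.
    by rewrite /i; have := ltn_ord j; lia.
  rewrite qbin_pascal qpowS.
  have -> : i.+1%:Z + j%:Z - j%:Z - n * j.+1%:Z = i.+1%:Z + - (n * j.+1%:Z).
    by lia.
  have -> : i.+1%:Z + j%:Z - j.+1%:Z - n * j.+2%:Z = (i%:Z - n) - n * j.+1%:Z.
    by lia.
  have -> : i.+1%:Z + j%:Z - n = (i%:Z - n) + j.+1%:Z by lia.
  have -> : k.+1%:Z = i.+1%:Z + j.+1%:Z.
    by rewrite /i; have := ltn_ord j; lia.
  rewrite !spD; ring.
(* [u 0] provides the extra [qbin n k] of the statement; the end term at k cancels the new-variable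
   part of the summand j = k, split off above. *)
rewrite !big_split /= -!mulr_sumr tele qpowS /u subnn /= !subr0 mulr1 subn0.
have -> : k%:Z - k%:Z - n * k.+1%:Z = - (n * k.+1%:Z) by lia.
by rewrite (mulr1 n); ring.
Qed.

(** The extra [qbin n k] in [newton_sumS] accounts for the step from multiplicity k to k+1, so the
    defect obeys a homogeneous recursion. *)
Lemma newton_defectS n k :
  newton_sum (n + 1) k.+1 - qbin (n + 1) k.+1 *+ k.+1 =
  sp k.+1%:Z * (newton_sum n k.+1 - qbin n k.+1 *+ k.+1)
  + sp (k%:Z - n) * (newton_sum n k - qbin n k *+ k).
Proof. by rewrite newton_sumS qbin_pascal mulrS; ring. Qed.

(* Newton's identity at [s^(n-1), s^(n-3), .., s^(1-n)], whose elementary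
   symmetric functions are the [qbin n k]; the recursion in [n] also runs
   backwards, which extends it to negative [n]. *)
Lemma qbin_newton n k : newton_sum n k = qbin n k *+ k.
Proof.
apply/eqP; rewrite -subr_eq0; apply/eqP.
have N0 m : newton_sum m 0 - qbin m 0 *+ 0 = 0.
  by rewrite /newton_sum big_ord0 mulr0n subr0.
elim/int_ind: n k => [|n IHn|n IHn] k.
- suff -> : newton_sum 0 k = 0.
    case: k => [|k]; first by rewrite !mulr0n subr0.
    by rewrite (@qbin_small 0 k.+1 isT) mul0rn subr0.
  by apply: big1 => j _; rewrite /qpow mul0r brE oppr0 subrr mul0r mulr0.
- by case: k => [//|k]; rewrite -addn1 PoszD newton_defectS !IHn !mulr0 addr0.
(* Going down in n, the recursion reads 0 = s^(k+1) times the defect, and the values of [sp] are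
   invertible. *)
- elim: k => [//|k IHk]; have := newton_defectS (- n.+1%:Z) k.
  have -> : - n.+1%:Z + 1 = - n%:Z by lia.
  rewrite IHn IHk mulr0 addr0 => /esym/(congr1 ( *%R (sp (- k.+1%:Z)))).
  by rewrite mulrA -spD addNr sp0 mul1r mulr0.
Qed.

End QuantumBinomial.

(** * Convergent sums in the completion *)

Lemma fsum_nat (V : zmodType) (F : nat -> V) N : (forall k, (N <= k)%N -> F k = 0) ->
  \sum_(k \in [set: nat]) F k = \sum_(k < N) F k.
Proof.
move=> F0; rewrite (fsumTE (finite_II N)) => [|k /=]; last first.
  by rewrite ltnNge; apply: contra_neqN => /F0.
rewrite -(big_mkord xpredT F); apply: perm_big; apply: uniq_perm.
- exact: fset_uniq.
- exact: iota_uniq.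
move=> k; rewrite in_fset_set ?mem_index_iota; last exact: finite_II.
by apply/idP/idP => [|kN]; rewrite ?inE //= in_setE.
Qed.

Section Truncation.
Variables (S : comNzRingType) (br : int -> S) (delta : {additive Z2 -> int}).
Local Notation H := (Ahat br delta).
Implicit Types (f g h : H) (l m : Z2) (u v : nat -> H).

Lemma hatB f g l : (f - g) l = f l - g l.
Proof. by rewrite /= scaleN1r. Qed.

Lemma hatN (f : H) l : (- f) l = - f l.
Proof. by rewrite /= scaleN1r. Qed.

Lemma hatD (f g : H) l : (f + g) l = f l + g l.
Proof. by []. Qed.

Lemma hatZ a (f : H) l : (a *: f) l = a *: f l.
Proof. by []. Qed.

Lemma hat_sum (I : Type) (r : seq I) (F : I -> H) l :
  (\sum_(i <- r) F i) l = \sum_(i <- r) F i l.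
Proof. by apply: (big_morph (fun f : H => f l)). Qed.

(** Equality modulo components of delta-degree above n; convergence in the completion is tested on
    these truncations. *)
Definition hat_eq_le (n : int) f g := forall l, delta l <= n -> f l = g l.

Lemma hat_eq_le_sub n f g : hat_eq_le n f g <-> hat_eq_le n (f - g) 0.
Proof.
split=> fg l ln; first by rewrite hatB fg // subrr.
by apply/eqP; rewrite -subr_eq0 -hatB fg.
Qed.

Lemma hat_lb f : exists b : int, forall l, f l != 0 -> b <= delta l.
Proof. exact/in_hat_lb/hat_compP. Qed.

(** Since [f] starts in degree b, only components of [g] and [h] of degree at most n - b contribute
    up to degree n. *)
Lemma hat_eq_le_mull f g h (b n : int) : (forall l, f l != 0 -> b <= delta l) ->
  hat_eq_le (n - b) g h -> hat_eq_le n (f * g) (f * h).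
Proof.
move=> fb /hat_eq_le_sub gh; apply/hat_eq_le_sub => l ln; rewrite -mulrBr.
apply/eqP; apply/negP => /negP/conv_neq0[m /fb bm] /eqP; apply.
by apply: gh; rewrite raddfB lerB.
Qed.

Lemma hat_eq_le_mulr f g h (b n : int) : (forall l, f l != 0 -> b <= delta l) ->
  hat_eq_le (n - b) g h -> hat_eq_le n (g * f) (h * f).
Proof.
move=> fb /hat_eq_le_sub gh; apply/hat_eq_le_sub => l ln; rewrite -mulrBl.
apply/eqP; apply/negP => /negP/conv_neq0[m /eqP + /fb].
rewrite raddfB => gm bm; apply: gm; apply: gh.
by rewrite lerBrDr; apply: le_trans ln; rewrite -lerBrDl.
Qed.

Lemma summable_bound u : summable u -> forall n, exists N, forall k,
  (N <= k)%N -> hat_eq_le n (u k) 0.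
Proof.
move=> su n; pose D := fset_set [set p : nat * Z2 | delta p.2 <= n /\ u p.1 p.2 != 0].
(* Every index of a nonzero component in this range is a summand here, hence below the bound. *)
exists (\sum_(p <- D) p.1).+1 => k Nk l ln.
apply/eqP; apply/negP => /negP ukl.
have kD : (k, l) \in D by rewrite in_fset_set // inE.
by move: Nk; rewrite (big_rem _ kD) /= ltnNge leq_addr.
Qed.

Lemma bound_summable u : (forall n, exists N, forall k,
  (N <= k)%N -> hat_eq_le n (u k) 0) -> summable u.
Proof.
move=> bu n; have [N uN] := bu n.
apply: (@sub_finite_set _ _ (\bigcup_(k in [set k | (k < N)%N])
  ((pair k) @` [set l | delta l <= n /\ (u k) l != 0]))%classic).
  move=> [k l] /= [ln ukl]; exists k; last by exists l.
  by rewrite /= ltnNge; apply: contra_neqN ukl => /uN ->.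
apply: bigcup_finite => [|k _]; first exact: finite_II.
by apply: finite_image; apply: (hat_compP _).2.
Qed.

(** Holding for every later N', it lets several series be cut off at one common index. *)
Lemma hsum_approx u (su : summable u) n : exists N, forall N', (N <= N')%N ->
  hat_eq_le n (hsum su) (\sum_(k < N') u k).
Proof.
have [N uN] := summable_bound su n; exists N => N' NN' l ln.
rewrite hat_sum /= (fsum_nat (N := N')) // => k Nk.
by rewrite uN // (leq_trans NN').
Qed.

Lemma eq_hsum u v (su : summable u) (sv : summable v) :
  u =1 v -> hsum su = hsum sv.
Proof. by move=> uv; apply/hatP => l /=; apply: eq_fsbigr => k _; rewrite uv. Qed.

Lemma hsum_mulr u f (su : summable u) (suf : summable (fun k => u k * f)) :
  hsum su * f = hsum suf.
Proof.
apply/hatP => l; have [b fb] := hat_lb f.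
have [N1 h1] := hsum_approx su (delta l - b).
have [N2 h2] := hsum_approx suf (delta l).
rewrite (hat_eq_le_mulr fb (h1 _ (leq_maxl N1 N2))) //.
by rewrite (h2 _ (leq_maxr N1 N2)) // mulr_suml.
Qed.

Lemma hsum_mull u f (su : summable u) (suf : summable (fun k => f * u k)) :
  f * hsum su = hsum suf.
Proof.
apply/hatP => l; have [b fb] := hat_lb f.
have [N1 h1] := hsum_approx su (delta l - b).
have [N2 h2] := hsum_approx suf (delta l).
rewrite (hat_eq_le_mull fb (h1 _ (leq_maxl N1 N2))) //.
by rewrite (h2 _ (leq_maxr N1 N2)) // mulr_sumr.
Qed.

Lemma summable_mull u f : summable u -> summable (fun k => f * u k).
Proof.
move=> /summable_bound su; apply: bound_summable => n.
have [b fb] := hat_lb f; have [N uN] := su (n - b); exists N => k Nk.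
by rewrite -(mulr0 f); apply: (hat_eq_le_mull fb); exact: uN.
Qed.

Lemma summable_mulr u f : summable u -> summable (fun k => u k * f).
Proof.
move=> /summable_bound su; apply: bound_summable => n.
have [b fb] := hat_lb f; have [N uN] := su (n - b); exists N => k Nk.
by rewrite -(mul0r f); apply: (hat_eq_le_mulr fb); exact: uN.
Qed.

Lemma comm_hsum u f (su : summable u) :
  (forall k, GRing.comm f (u k)) -> GRing.comm f (hsum su).
Proof.
move=> fu; rewrite /GRing.comm (hsum_mull su (summable_mull f su)).
rewrite (hsum_mulr su (summable_mulr f su)); apply: eq_hsum => k; exact: fu.
Qed.

Lemma summableS u : summable u -> summable (u \o succn).
Proof.
move=> /summable_bound su; apply: bound_summable => n.
by have [N uN] := su n; exists N => k Nk; apply: uN; exact: leqW.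
Qed.

Lemma hsum_recl u (su : summable u) : hsum su = u 0%N + hsum (summableS su).
Proof.
apply/hatP => l; have [N1 h1] := hsum_approx su (delta l).
have [N2 h2] := hsum_approx (summableS su) (delta l).
rewrite (h1 (maxn N1 N2).+1 (leqW (leq_maxl N1 N2))) // big_ord_recl /=.
by congr (_ + _); rewrite -(h2 _ (leq_maxr N1 N2)) // hat_sum.
Qed.

End Truncation.

(** * Euler derivations *)

Section Euler.
Variables (S : comNzRingType) (br : int -> S) (delta : {additive Z2 -> int}).
Local Notation H := (Ahat br delta).
Implicit Types (f g h : H) (l m : Z2) (u v : nat -> H).
Variable phi : {additive Z2 -> int}.

Fact euler_in_hat f : in_hat delta (fun l => (phi l)%:~R *: f l).
Proof.
split=> [l|n]; first by apply: homog_Z; exact: (hat_compP f).1.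
refine (sub_finite_set _ ((hat_compP f).2 n)) => l [ln fl]; split; first exact: ln.
by apply: contra_neq fl => ->; rewrite scaler0.
Qed.

Definition euler f : H := Hat (euler_in_hat f).

Fact euler_is_additive : zmod_morphism euler.
Proof.
by move=> f g; apply/hatP => l; rewrite hatB /= scaleN1r scalerDr scalerN.
Qed.
HB.instance Definition _ := GRing.isZmodMorphism.Build H H euler euler_is_additive.

Lemma eulerZ c f : euler (c *: f) = c *: euler f.
Proof. by apply/hatP => l /=; rewrite !scalerA mulrC. Qed.

Lemma eulerM f g : euler (f * g) = euler f * g + f * euler g.
Proof.
apply/hatP => l; rewrite /= /conv /=.
rewrite -fsumTD; last 2 first.
- exact: (conv_fin l (hat_compP (euler f)) (hat_compP g)).
- exact: (conv_fin l (hat_compP f) (hat_compP (euler g))).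
rewrite fsumT_scale; last exact: (conv_fin l (hat_compP f) (hat_compP g)).
apply: eq_fsbigr => m _; rewrite -scalerAl -scalerAr -scalerDl -intrD.
by rewrite -raddfD subrKC.
Qed.

Lemma euler1 : euler 1 = 0.
Proof.
apply: (@addrI _ (euler 1)).
by rewrite addr0 -[in RHS](mulr1 1) eulerM mulr1 mul1r.
Qed.

Lemma euler_hP x : euler (hP br delta x) = (phi x)%:~R *: hP br delta x.
Proof. by apply/hatP => l /=; have [->|_] := eqVneq l x; rewrite ?scaler0. Qed.

Lemma summable_euler u : summable u -> summable (euler \o u).
Proof.
move=> /summable_bound su; apply: bound_summable => n.
by have [N uN] := su n; exists N => k Nk l ln /=; rewrite uN // scaler0.
Qed.

Lemma euler_hsum u (su : summable u) : euler (hsum su) = hsum (summable_euler su).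
Proof.
apply/hatP => l; have [N1 h1] := hsum_approx su (delta l).
have [N2 h2] := hsum_approx (summable_euler su) (delta l).
rewrite (h2 _ (leq_maxr N1 N2)) // /= -(raddf_sum euler) /=.
by rewrite -(h1 _ (leq_maxl N1 N2)).
Qed.

Lemma eulerX f n : GRing.comm f (euler f) ->
  euler (f ^+ n.+1) = n.+1%:R *: (euler f * f ^+ n).
Proof.
move=> cf; elim: n => [|n IHn]; first by rewrite scale1r mulr1.
rewrite exprS eulerM IHn -scalerAr mulrA cf -mulrA -exprS.
move: (euler f * _) => g.
by rewrite -[in RHS]natr1 [RHS]scalerDl scale1r addrC.
Qed.

(* At a nonzero component of minimal delta-degree, the right-hand side of the
   Euler equation vanishes. *)
Lemma euler_unique X Y D : (forall n : int, n != 0 -> exists c : S, c * n%:~R = 1) ->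
  pos_degree X -> pos_degree Y -> euler D = X * D + D * Y ->
  (forall l, D l != 0 -> phi l != 0) -> D = 0.
Proof.
move=> char0 pX pY ED D0; have [b Db] := hat_lb D.
suff Dn (n : nat) l : delta l < b + n%:Z -> D l = 0.
  apply/hatP => l; apply: (Dn `|delta l - b|.+1).
  by move: (delta l) => d; lia.
elim: n l => [|n IHn] l ln.
  by apply/eqP; apply/negP => /negP/Db; rewrite leNgt -(addr0 b) ln.
apply/eqP; apply/negP => /negP Dl.
have [c cE] := char0 _ (D0 _ Dl).
have : (euler D) l = 0.
  rewrite ED /= [X in X + _](_ : _ = 0) ?add0r.
    apply/eqP; apply/negP => /negP/conv_neq0[m Dm /pY].
    move=> lm; move: Dm; rewrite IHn ?eqxx //.
    by move: lm ln; rewrite (raddfB delta); move: (delta _) (delta _) => p q; lia.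
  apply/eqP; apply/negP => /negP/conv_neq0[m /pX dm].
  rewrite IHn ?eqxx // (raddfB delta); move: dm ln.
  by move: (delta _) (delta _) => p q; lia.
move=> /(congr1 ( *:%R c)) /=; rewrite scalerA cE scale1r scaler0 => /eqP.
by rewrite (negbTE Dl).
Qed.

(** Filtration by phi-degree; level 1 certifies the support hypothesis of [euler_unique]. *)
Definition phi_ge (n : int) f := forall l, f l != 0 -> n <= phi l.

Lemma phi_geW n n' f : n' <= n -> phi_ge n f -> phi_ge n' f.
Proof. by move=> nn' hf l /hf; exact: le_trans. Qed.

Lemma phi_geM n n' f g : phi_ge n f -> phi_ge n' g -> phi_ge (n + n') (f * g).
Proof.
move=> hf hg l /conv_neq0[m /hf fm /hg gm].
by rewrite -(subrKC m l) raddfD lerD.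
Qed.

Lemma phi_geM0 n f g : phi_ge n f -> phi_ge 0 g -> phi_ge n (f * g).
Proof. by move=> hf hg; have := phi_geM hf hg; rewrite (addr0 n). Qed.

Lemma phi_ge0M n f g : phi_ge 0 f -> phi_ge n g -> phi_ge n (f * g).
Proof. by move=> hf hg; have := phi_geM hf hg; rewrite (add0r n). Qed.

Lemma phi_geD n f g : phi_ge n f -> phi_ge n g -> phi_ge n (f + g).
Proof.
move=> hf hg l /=; have [->|fl _] := eqVneq (f l) 0; last exact: hf.
by rewrite add0r; exact: hg.
Qed.

Lemma phi_geZ n c f : phi_ge n f -> phi_ge n (c *: f).
Proof.
by move=> hf l cf; apply: hf; apply: contra_neq cf => /= ->; rewrite scaler0.
Qed.

Lemma phi_geB n f g : phi_ge n f -> phi_ge n g -> phi_ge n (f - g).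
Proof. by move=> hf hg; rewrite -scaleN1r; apply/phi_geD/phi_geZ. Qed.

Lemma phi_ge_hsum n u (su : summable u) : (forall k, phi_ge n (u k)) ->
  phi_ge n (hsum su).
Proof. by move=> hu l /fsum_neq0[k /hu]. Qed.

Lemma phi_ge_1 : phi_ge 0 1.
Proof. by move=> l /=; have [->|_] := eqVneq l 0; rewrite ?raddf0 ?eqxx. Qed.

Lemma phi_ge_hP x : phi_ge (phi x) (hP br delta x).
Proof. by move=> l /=; have [->|_] := eqVneq l x; rewrite ?eqxx. Qed.

Lemma phi_geX n f : phi_ge 0 f -> phi_ge 0 (f ^+ n).
Proof.
move=> hf; elim: n => [|n IHn]; first exact: phi_ge_1.
by rewrite exprS; exact: phi_geM0.
Qed.

Section Exponential.
Variable fi : nat -> S.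
Hypotheses (fi0 : fi 0%N = 1) (fiS : forall n, fi n.+1 * n.+1%:R = fi n).
Variables (X : H) (pX : pos_degree X).
Let E : H := hsum (summable_powers fi pX).

(** With [fi n] in the role of 1/n!, the derivative of the term n+1 is [euler X] times the term n,
    as X commutes with [euler X]. *)
Lemma euler_exp : GRing.comm X (euler X) -> euler E = euler X * E.
Proof.
move=> cX; rewrite /E euler_hsum hsum_recl /= expr0 fi0 scale1r euler1 add0r.
rewrite (hsum_mull _ (summable_mull _ (summable_powers fi pX))).
apply: eq_hsum => k; rewrite [LHS]/= eulerZ (eulerX _ cX) scalerA fiS.
exact: scalerAr.
Qed.

Lemma comm_exp f : GRing.comm f X -> GRing.comm f E.
Proof.
move=> fX; apply: comm_hsum => k; rewrite /GRing.comm -scalerAr -scalerAl.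
by rewrite (commrX k fX).
Qed.

Lemma phi_ge_exp : phi_ge 0 X -> phi_ge 0 E.
Proof. by move=> hX; apply: phi_ge_hsum => k; apply/phi_geZ/phi_geX. Qed.

Lemma phi_ge_expB1 : phi_ge 1 X -> phi_ge 1 (E - 1).
Proof.
move=> hX; rewrite /E hsum_recl expr0 fi0 scale1r addrC addKr.
apply: phi_ge_hsum => k; apply: phi_geZ; rewrite exprS.
apply: phi_geM0; first exact: hX.
by apply: phi_geX; apply: phi_geW hX.
Qed.

End Exponential.
End Euler.

(** * Series supported on a ray *)

Lemma omega_addr a b c : omega a (b + c) = omega a b + omega a c.
Proof. by rewrite /omega /=; ring. Qed.

Lemma omegaC a b : omega a b = - omega b a.
Proof. by rewrite /omega; ring. Qed.

Lemma omega_addl a b c : omega (a + b) c = omega a c + omega b c.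
Proof. by rewrite omegaC omega_addr opprD -!omegaC. Qed.

Lemma omegaxx a : omega a a = 0.
Proof. by rewrite /omega mulrC subrr. Qed.

Lemma omega_mulnr a b k : omega a (b *+ k) = omega a b * k%:Z.
Proof.
elim: k => [|k IHk]; first by rewrite mulr0n mulr0 /omega /= !mulr0 subrr.
by rewrite mulrS omega_addr IHk; lia.
Qed.

Lemma omega_mulnl a b k : omega (a *+ k) b = omega a b * k%:Z.
Proof. by rewrite omegaC omega_mulnr omegaC; lia. Qed.

Lemma additive_muln (phi : {additive Z2 -> int}) y k : phi (y *+ k) = phi y * k%:Z.
Proof. by rewrite raddfMn -mulr_natr natz. Qed.

(** The functional omega(-, y), named so that it can carry an additive structure. *)
Definition omegar (y x : Z2) : int := omega x y.

Fact omega_is_additive a : zmod_morphism (omega a).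
Proof. by move=> b c; rewrite /omega /=; ring. Qed.
HB.instance Definition _ a :=
  GRing.isZmodMorphism.Build Z2 int (omega a) (omega_is_additive a).

Fact omegar_is_additive a : zmod_morphism (omegar a).
Proof. by move=> b c; rewrite /omegar /omega /=; ring. Qed.
HB.instance Definition _ a :=
  GRing.isZmodMorphism.Build Z2 int (omegar a) (omegar_is_additive a).

(** Pairing with y and with x reads off the coordinates m and k. *)
Lemma lattice_inj x y m k m' k' : omega x y = 1 ->
  x + x *+ m + y *+ k = x + x *+ m' + y *+ k' -> m = m' /\ k = k'.
Proof.
move=> xy E; split.
  have := congr1 (omegar y) E; rewrite /omegar !omega_addl !omega_mulnl xy omegaxx.
  by lia.
have := congr1 (omega x) E; rewrite !omega_addr !omega_mulnr xy omegaxx.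
by lia.
Qed.

Section Rays.
Variables (S : comNzRingType) (br : int -> S) (delta : {additive Z2 -> int}).
Local Notation H := (Ahat br delta).
Local Notation P := (hP br delta).
Implicit Types (z y : Z2) (c d : nat -> S).

Lemma hsingleM a b (u v : PAlg br) (hu : homog a u) (hv : homog b v) l :
  (hsingle delta hu * hsingle delta hv) l = if l == a + b then u * v else 0.
Proof.
rewrite /= /conv (fsumT_single (j := a)) /= => [|m /negbTE->]; last exact: mul0r.
by rewrite eqxx subr_eq (addrC b); case: eqP => // _; rewrite mulr0.
Qed.

Lemma hP_comm a b : a != 0 -> b != 0 ->
  P a * P b - P b * P a = br (omega a b) *: P (a + b).
Proof.
move=> a0 b0; apply/hatP => l; rewrite hatB !hsingleM (addrC b) /=.
by case: eqP => _; rewrite ?genP_comm // subrr scaler0.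
Qed.

Fact summable_ray c z y (dy : 0 < delta y) :
  summable (fun k => c k *: P (z + y *+ k)).
Proof.
apply: bound_summable => n; exists `|n - delta z|.+1 => k Nk l ln /=.
case: eqP => [lE|_]; rewrite ?scaler0 //.
suff : n < delta l by rewrite ltNge ln.
rewrite lE (raddfD delta) additive_muln.
by move: (delta y) (delta z) dy Nk => a b; nia.
Qed.

(** With z = y this is the shape of log Q_y and of its Euler derivative; with z off the direction y,
    that of the conjugates of [P z]. *)
Definition ray c z y (dy : 0 < delta y) : H := hsum (summable_ray c z dy).

Lemma eq_ray c d z y (dy : 0 < delta y) : c =1 d -> ray c z dy = ray d z dy.
Proof. by move=> cd; apply: eq_hsum => k; rewrite cd. Qed.

Lemma ray_inj y k m z : 0 < delta y -> z + y *+ k = z + y *+ m -> k = m.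
Proof.
move=> dy /addrI /(congr1 delta); rewrite (additive_muln _ y k) (additive_muln _ y m).
by move: (delta y) dy => a; nia.
Qed.

Lemma ray_at c z y (dy : 0 < delta y) k :
  ray c z dy (z + y *+ k) = c k *: genP br (z + y *+ k).
Proof.
rewrite /= (fsumT_single (j := k)) => [|m mk /=]; first by rewrite eqxx.
case: eqP => [/(ray_inj dy) km|_]; last exact: scaler0.
by rewrite km eqxx in mk.
Qed.

Lemma ray_out c z y (dy : 0 < delta y) l : (forall k, l <> z + y *+ k) ->
  ray c z dy l = 0.
Proof.
move=> lz; apply: fsbig1 => k _ /=; case: eqP => [/lz//|_]; exact: scaler0.
Qed.

(** Bracketing P_(z+ky) with P_((j+1)y) gives {omega(z,y)(j+1)} P_(z+(k+j+1)y), as omega(y,y) = 0;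
    the coefficient at K collects k + j + 1 = K. *)
Lemma ray_comm c d z y (dy : 0 < delta y) : (forall k, z + y *+ k != 0) ->
  ray c z dy * ray d y dy - ray d y dy * ray c z dy =
  ray (fun K => \sum_(j < K) c (K.-1 - j)%N * d j * br (omega z y * j.+1%:Z)) z dy.
Proof.
move=> z0.
have y0 j : y *+ j.+1 != 0.
  apply/eqP => /(congr1 delta); rewrite additive_muln (raddf0 delta).
  by move: (delta y) dy => a; nia.
(* The bracket with the term j of the second ray is again a ray, starting at z + (j+1)y. *)
pose R j := d j *: ray (fun k => c k * br (omega z y * j.+1%:Z)) (z + y *+ j.+1) dy.
have RE j : ray c z dy * (d j *: P (y + y *+ j)) -
            (d j *: P (y + y *+ j)) * ray c z dy = R j.
  rewrite -mulrS -scalerAr -scalerAl -scalerBr /R; congr (_ *: _).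
  rewrite (hsum_mulr _ (summable_mulr _ (summable_ray c z dy))).
  rewrite (hsum_mull _ (summable_mull _ (summable_ray c z dy))).
  apply/hatP => l; have [N1 h1] := hsum_approx
    (summable_mulr (P (y *+ j.+1)) (summable_ray c z dy)) (delta l).
  have [N2 h2] := hsum_approx
    (summable_mull (P (y *+ j.+1)) (summable_ray c z dy)) (delta l).
  have [N3 h3] := hsum_approx (summable_ray
    (fun k => c k * br (omega z y * j.+1%:Z)) (z + y *+ j.+1) dy) (delta l).
  pose N := maxn N1 (maxn N2 N3).
  rewrite hatB (h1 N) ?(h2 N) ?[RHS](h3 N) /N ?leq_max ?leqnn ?orbT //.
  rewrite -hatB -sumrB; congr (hat_comp _ _); apply: eq_bigr => k _.
  rewrite -scalerAl -scalerAr -scalerBr hP_comm // scalerA.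
  rewrite omega_addl omega_mulnr omega_mulnl omega_mulnr omegaxx !mul0r addr0.
  by rewrite -!addrA (addrC (y *+ k)).
have sR : summable R.
  apply: bound_summable => n; have [N1 h1] := summable_bound
    (summable_mulr (ray c z dy) (summable_ray d y dy)) n.
  have [N2 h2] := summable_bound
    (summable_mull (ray c z dy) (summable_ray d y dy)) n.
  exists (maxn N1 N2) => k; rewrite geq_max => /andP[k1 k2] l ln.
  apply: etrans (congr1 (fun f : H => f l) (esym (RE k))) _; rewrite hatB.
  by rewrite (h2 k k2 l ln) [X in _ - X](h1 k k1 l ln); exact: subrr.
transitivity (hsum sR).
  rewrite (hsum_mull (summable_ray d y dy) (summable_mull (ray c z dy) (summable_ray d y dy))).
  rewrite (hsum_mulr (summable_ray d y dy) (summable_mulr (ray c z dy) (summable_ray d y dy))).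
  apply/hatP => l; have [N1 h1] := hsum_approx
    (summable_mulr (ray c z dy) (summable_ray d y dy)) (delta l).
  have [N2 h2] := hsum_approx
    (summable_mull (ray c z dy) (summable_ray d y dy)) (delta l).
  have [N3 h3] := hsum_approx sR (delta l).
  pose N := maxn N1 (maxn N2 N3).
  rewrite hatB (h1 N) ?(h2 N) ?[RHS](h3 N) /N ?leq_max ?leqnn ?orbT //.
  by rewrite -hatB -sumrB; congr (hat_comp _ _); apply: eq_bigr => k _; exact: RE.
apply/hatP => l; have [[K ->]|nl] := pselect (exists K, l = z + y *+ K); last first.
  rewrite ray_out => [|k lE]; last by apply: nl; exists k.
  apply: fsbig1 => j _ /=; rewrite [X in _ *: X]ray_out ?scaler0 // => k lE.
  by apply: nl; exists (j.+1 + k)%N; rewrite lE mulrnDr addrA.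
(* [R j] starts at z + (j+1)y, so only j < K reaches this point. *)
rewrite ray_at [LHS](fsum_nat (N := K)) => [|j Kj]; last first.
  rewrite /R /= [X in _ *: X]ray_out ?scaler0 // => k.
  by rewrite -addrA -mulrnDr => /(ray_inj dy); lia.
rewrite scaler_suml; apply: eq_bigr => j _.
have lE : z + y *+ K = (z + y *+ j.+1) + y *+ (K.-1 - j).
  by rewrite -addrA -mulrnDr; congr (_ + _ *+ _); have := ltn_ord j; lia.
rewrite lE; apply: etrans (congr1 ( *:%R (d j)) (ray_at _ _ _ _)) _.
rewrite scalerA; apply: (congr1 ( *:%R^~ _)).
by rewrite mulrA (mulrC (d j)).
Qed.

End Rays.

Section RayEuler.
Variables (S : comNzRingType) (br : int -> S) (delta : {additive Z2 -> int}).
Local Notation H := (Ahat br delta).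
Local Notation P := (hP br delta).
Implicit Types (z y : Z2) (c d : nat -> S).
Variable phi : {additive Z2 -> int}.

Lemma euler_ray c z y (dy : 0 < delta y) :
  euler phi (ray br c z dy) =
  ray br (fun k => (phi z + phi y * k%:Z)%:~R * c k) z dy.
Proof.
rewrite /ray euler_hsum; apply: eq_hsum => k.
rewrite [LHS]/= eulerZ euler_hP !scalerA (raddfD phi) additive_muln.
by rewrite mulrC.
Qed.

Lemma phi_ge_ray n c z y (dy : 0 < delta y) : n <= phi z -> 0 <= phi y ->
  phi_ge phi n (ray br c z dy).
Proof.
move=> pz py; apply: phi_ge_hsum => k; apply: phi_geZ.
apply: (phi_geW _ (@phi_ge_hP _ _ _ _ _)); rewrite (raddfD phi) additive_muln.
by move: (phi y) (phi z) py pz => a b; nia.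
Qed.

Lemma ray_recl c z y (dy : 0 < delta y) :
  ray br c z dy = c 0%N *: P z + ray br (c \o succn) (z + y) dy.
Proof.
rewrite /ray hsum_recl; apply: (f_equal2 +%R).
  by apply: (congr1 (fun a => c 0%N *: P a)); rewrite addr0.
by apply: eq_hsum => k /=; rewrite mulrS addrA.
Qed.

Lemma rayN c z y (dy : 0 < delta y) : - ray br c z dy = ray br (fun k => - c k) z dy.
Proof.
apply/hatP => l; have [[K ->]|nl] := pselect (exists K, l = z + y *+ K).
  by rewrite ray_at hatN ray_at scaleNr.
have nl' k : l <> z + y *+ k by move=> lE; apply: nl; exists k.
by rewrite (ray_out _ _ _ nl') hatN (ray_out _ _ _ nl') oppr0.
Qed.

Lemma pos_degree_ray c z y (dz : 0 < delta z) (dy : 0 < delta y) :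
  pos_degree (ray br c z dy).
Proof.
move=> l /fsum_neq0[k /=]; have [-> _|_] := eqVneq l (z + y *+ k); last first.
  by rewrite scaler0 eqxx.
rewrite (raddfD delta) additive_muln.
by move: (delta y) (delta z) dy dz => a b; nia.
Qed.

End RayEuler.

(** Serves to split the difference of the sides of [hP_baxter], with p = [P z] and t its conjugate,
    into three pieces of phi-degree at least 1. *)
Lemma subr_telescope (V : zmodType) (a b p t : V) :
  a - b = a - p - (b - t) - (t - p).
Proof. by rewrite !opprB -addrA [t - b + _]addrC !subrKA. Qed.

(** * Conjugation of generators by Baxter operators *)

Section Commutation.
Variables (S : comNzRingType) (sp br : int -> S) (brV fi inv : nat -> S).
Variable delta : {additive Z2 -> int}.
Local Notation H := (Ahat br delta).
Local Notation P := (hP br delta).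
Hypotheses (sp0 : sp 0 = 1) (spD : {morph sp : a b / a + b >-> a * b}).
Hypothesis brE : forall k, br k = sp k - sp (- k).
Hypothesis brVK : forall k : nat, brV k.+1 * br k.+1 = 1.
Hypotheses (fi0 : fi 0%N = 1) (fiS : forall n, fi n.+1 * n.+1%:R = fi n).
Hypothesis invK : forall n : nat, inv n.+1 * n.+1%:R = 1.

Lemma intr_invertible (n : int) : n != 0 -> exists c : S, c * n%:~R = 1.
Proof.
case: n => [[//|n]|n] _; first by exists (inv n.+1); exact: invK.
by exists (- inv n.+1); rewrite NegzE mulrNz mulrNN; exact: invK.
Qed.

Lemma phi_ge1_neq0 (phi : {additive Z2 -> int}) (f : H) : phi_ge phi 1 f ->
  forall l, f l != 0 -> phi l != 0.
Proof. by move=> hf l /hf; apply: contraTneq => ->. Qed.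

Lemma pos_degree0 : pos_degree (0 : H).
Proof. by move=> l; rewrite eqxx. Qed.

Definition log_coef (t : S) (n : nat) : S := - (- t) ^+ n * inv n * brV n.

Definition ray_log (y : Z2) (dy : 0 < delta y) t : H :=
  ray br (fun k => log_coef t k.+1) y dy.

Lemma pos_degree_log y (dy : 0 < delta y) t : pos_degree (ray_log dy t).
Proof. exact: pos_degree_ray. Qed.

(** [Baxter] over abstract scalars: [fi n], [inv n], [brV n] stand for 1/n!, 1/n, 1/{n}. [BaxterE]
    identifies the two. *)
Definition baxter y (dy : 0 < delta y) t : H :=
  hsum (summable_powers fi (@pos_degree_log y dy t)).

(** The Euler weight phi(y)(k+1) of the term k cancels the 1/(k+1) of [log_coef], leaving phi(y)
    times this series. *)
Definition ray_dlog (y : Z2) (dy : 0 < delta y) t : H :=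
  ray br (fun k => - (- t) ^+ k.+1 * brV k.+1) y dy.

Lemma euler_log (phi : {additive Z2 -> int}) y (dy : 0 < delta y) t :
  euler phi (ray_log dy t) = (phi y)%:~R *: ray_dlog dy t.
Proof.
rewrite euler_ray; apply/hatP => l.
have [[K ->]|nl] := pselect (exists K, l = y + y *+ K); last first.
  have nl' k : l <> y + y *+ k by move=> lE; apply: nl; exists k.
  by rewrite (ray_out _ _ _ nl') hatZ (ray_out _ _ _ nl') scaler0.
rewrite ray_at hatZ ray_at scalerA; apply: (congr1 ( *:%R^~ _)).
rewrite /log_coef; have -> : phi y + phi y * K = phi y * K.+1%:Z by lia.
have := invK K; move: (brV _) (inv _) (- t) => b i u iK.
rewrite intrM -!mulrA; apply: (congr1 ( *%R _)).
rewrite mulrCA; apply: (congr1 ( *%R _)).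
by rewrite mulrA (mulrC _ i) [X in X * b]iK mul1r.
Qed.

Lemma ray_ray_comm c d y (dy : 0 < delta y) :
  GRing.comm (ray br c y dy) (ray br d y dy).
Proof.
apply/eqP; rewrite -subr_eq0; apply/eqP; rewrite ray_comm; last first.
  move=> k; apply/eqP => /(congr1 delta).
  rewrite (raddfD delta) additive_muln (raddf0 delta).
  by move: (delta y) dy => a; nia.
rewrite (@eq_ray _ _ _ _ (fun=> 0)) => [|K].
  by apply/hatP => l; apply: fsbig1 => k _ /=; rewrite scale0r.
apply: big1 => j _.
by rewrite omegaxx mul0r brE oppr0 subrr mulr0.
Qed.

Lemma baxter_comm y (dy : 0 < delta y) t c :
  GRing.comm (ray br c y dy) (baxter dy t).
Proof. by apply: comm_exp; exact: ray_ray_comm. Qed.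

Lemma euler_baxter (phi : {additive Z2 -> int}) y (dy : 0 < delta y) t :
  euler phi (baxter dy t) = (phi y)%:~R *: ray_dlog dy t * baxter dy t.
Proof.
rewrite -euler_log; apply: euler_exp => //.
by rewrite euler_ray; exact: ray_ray_comm.
Qed.

(** The conjugate of [P z] by Q_y: Q_y^(-1) P_z Q_y for n = omega(z,y) in [hP_baxter], Q_y P_z
    Q_y^(-1) for n = omega(y,z) in [baxter_hP]. *)
Definition qray n z y (dy : 0 < delta y) t : H :=
  ray br (fun k => qbin br brV n k * t ^+ k) z dy.

Section Lattice.
Variables (phi : {additive Z2 -> int}) (z y : Z2) (dy : 0 < delta y) (t : S).
Hypotheses (phiz : phi z = 0) (phiy : phi y = 1) (z0 : z != 0).

Lemma ray_neq0 k : z + y *+ k != 0.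
Proof.
have [->|k0] := eqVneq k 0%N; first by rewrite mulr0n addr0.
apply/eqP => /(congr1 phi).
by rewrite (raddfD phi) additive_muln (raddf0 phi) phiz phiy; move: k0; lia.
Qed.

Lemma phi_ge_baxterB1 : phi_ge phi 1 (baxter dy t - 1).
Proof. by apply: (phi_ge_expB1 fi0); apply: phi_ge_ray; rewrite phiy. Qed.

Lemma phi_ge_qrayB n : phi_ge phi 1 (qray n z dy t - P z).
Proof.
rewrite /qray ray_recl mulr1 scale1r addrC addKr.
by apply: phi_ge_ray; rewrite ?(raddfD phi) ?phiz phiy.
Qed.

(** For n = omega(z,y) the left side is the bracket of [qray] with [ray_dlog] given by [ray_comm].
    By Newton's identity its coefficient at K is K [n, K] t^K, and K is the Euler weight of z +
    Ky. *)
Lemma newton_ray n :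
  ray br (fun K => \sum_(j < K) qbin br brV n (K.-1 - j)%N * t ^+ (K.-1 - j) *
     (- (- t) ^+ j.+1 * brV j.+1) * br (n * j.+1%:Z)) z dy =
  euler phi (qray n z dy t).
Proof.
rewrite euler_ray; apply: eq_ray => K.
rewrite phiz phiy add0r mul1r mulrA -[K%:~R]/(K%:R) mulr_natl.
rewrite -(qbin_newton sp0 spD brE brVK) mulr_suml; apply: eq_bigr => j _.
have -> : t ^+ K = t ^+ (K.-1 - j) * t ^+ j.+1.
  by rewrite -exprD; congr (_ ^+ _); have := ltn_ord j; lia.
rewrite /qpow (exprNn t j.+1) [in LHS]exprS.
move: (qbin _ _ _ _) (t ^+ (_ - _)) (t ^+ j.+1) (_ ^+ j) (br _) (brV _) => a b c d e f.
ring.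
Qed.

(** The difference D of the two sides satisfies E D = D L, because L commutes with Q_y and E T =
    [T, L] by [newton_ray]; both sides are [P z] modulo phi-degree 1. *)
Lemma hP_baxter : P z * baxter dy t = baxter dy t * qray (omega z y) z dy t.
Proof.
set Q := baxter dy t; set L := ray_dlog dy t; set T := qray _ _ _ _.
have EQ : euler phi Q = L * Q by rewrite euler_baxter phiy scale1r.
have LQ : L * Q = Q * L by exact: baxter_comm.
have ET : euler phi T = T * L - L * T.
  by rewrite -newton_ray; exact/esym/ray_comm/ray_neq0.
apply/eqP; rewrite -subr_eq0; apply/eqP.
apply: (euler_unique (phi := phi) (X := 0) (Y := L) intr_invertible pos_degree0).
- exact: pos_degree_ray.
- rewrite raddfB /= !eulerM euler_hP phiz scale0r !mul0r !add0r EQ LQ ET.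
  by rewrite mulrBl mulrBr !mulrA [_ + (_ - _)]addrC subrK.
suff : phi_ge phi 1 (P z * Q - Q * T) by exact: phi_ge1_neq0.
have Q1 : phi_ge phi 1 (Q - 1) by exact: phi_ge_baxterB1.
have T0 : phi_ge phi 0 T by apply: phi_ge_ray; rewrite ?phiz ?phiy.
have T1 : phi_ge phi 1 (T - P z) by exact: phi_ge_qrayB.
have Pz : phi_ge phi 0 (P z) by have := @phi_ge_hP _ br delta phi z; rewrite phiz; exact.
have -> : P z * Q - Q * T = P z * (Q - 1) - (Q - 1) * T - (T - P z).
  by rewrite mulrBr mulr1 mulrBl mul1r; exact: subr_telescope.
apply: phi_geB; last exact: T1.
by apply: phi_geB; [exact: phi_ge0M Pz Q1|exact: phi_geM0 Q1 T0].
Qed.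

Lemma baxter_hP : baxter dy t * P z = qray (omega y z) z dy t * baxter dy t.
Proof.
set Q := baxter dy t; set L := ray_dlog dy t; set T := qray _ _ _ _.
have EQ : euler phi Q = L * Q by rewrite euler_baxter phiy scale1r.
(* Exchanging the arguments of omega negates every {k}, hence the bracket. *)
have ET : euler phi T = L * T - T * L.
  apply: etrans _ (opprB _ _); rewrite -newton_ray.
  apply: etrans _ (congr1 -%R (esym (ray_comm _ _ _ _ ray_neq0))).
  rewrite rayN; apply: eq_ray => K; rewrite -sumrN; apply: eq_bigr => j _.
  by rewrite -mulrN -(br_odd brE) -mulNr -omegaC.
apply/eqP; rewrite -subr_eq0; apply/eqP.
apply: (euler_unique (phi := phi) (X := L) (Y := 0) intr_invertible _ pos_degree0).
- exact: pos_degree_ray.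
- rewrite raddfB /= !eulerM euler_hP phiz scale0r !mulr0 !addr0 EQ ET.
  by rewrite mulrBl mulrBr !mulrA subrK.
suff : phi_ge phi 1 (Q * P z - T * Q) by exact: phi_ge1_neq0.
have Q1 : phi_ge phi 1 (Q - 1) by exact: phi_ge_baxterB1.
have T0 : phi_ge phi 0 T by apply: phi_ge_ray; rewrite ?phiz ?phiy.
have T1 : phi_ge phi 1 (T - P z) by exact: phi_ge_qrayB.
have Pz : phi_ge phi 0 (P z) by have := @phi_ge_hP _ br delta phi z; rewrite phiz; exact.
have -> : Q * P z - T * Q = (Q - 1) * P z - T * (Q - 1) - (T - P z).
  by rewrite mulrBr mulr1 mulrBl mul1r; exact: subr_telescope.
apply: phi_geB; last exact: T1.
by apply: phi_geB; [exact: phi_geM0 Q1 Pz|exact: phi_ge0M T0 Q1].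
Qed.

End Lattice.

(** * Double series over a cone *)

Section DoubleRay.
Variables (x y : Z2) (dx : 0 < delta x) (dy : 0 < delta y).
Variables (a : nat -> S) (c : nat -> nat -> S).

Fact summable_dray : summable (fun m => a m *: ray br (c m) (x + x *+ m) dy).
Proof.
apply: bound_summable => n; exists `|n|.+1 => m nm l ln; rewrite hatZ.
rewrite ray_out ?scaler0 // => k lE; move: ln.
rewrite lE !(raddfD delta) !additive_muln.
by move: (delta x) (delta y) dx dy => p q; nia.
Qed.

(** Collects the rays that arise when the terms of L_x are conjugated one by one. *)
Definition dray : H := hsum summable_dray.

Hypothesis xy : omega x y = 1.

Lemma dray_at m k : dray (x + x *+ m + y *+ k) =
  (a m * c m k) *: genP br (x + x *+ m + y *+ k).
Proof.
apply: etrans (fsumT_single (j := m) _) _ => [m' mm'|]; rewrite hatZ.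
  rewrite ray_out ?scaler0 // => k' /(lattice_inj xy)[mE _].
  by rewrite mE eqxx in mm'.
by rewrite ray_at scalerA.
Qed.

Lemma dray_out l : (forall m k, l <> x + x *+ m + y *+ k) -> dray l = 0.
Proof.
by move=> lE; apply: fsbig1 => m _; rewrite hatZ ray_out ?scaler0.
Qed.

End DoubleRay.

(** * The pentagon identity *)

Section Pentagon.
Variables (x y : Z2) (dx : 0 < delta x) (dy : 0 < delta y).
Variables (dxy : 0 < delta (x + y)) (xy : omega x y = 1) (v w : S).

Let a k : S := - (- v) ^+ k.+1 * brV k.+1.

Let x0 n : x + x *+ n != 0.
Proof.
apply/eqP => /(congr1 delta); rewrite (raddfD delta) additive_muln (raddf0 delta).
by move: (delta x) dx => p; nia.
Qed.

(** Termwise [hP_baxter] with phi = omega(x,-), which vanishes at z = (m+1)x; the upper index is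
    omega(z,y) = m+1. *)
Lemma dlog_baxter : ray_dlog dx v * baxter dy w = baxter dy w *
  dray dx dy a (fun m k => qbin br brV m.+1 k * w ^+ k).
Proof.
rewrite (hsum_mulr _ (summable_mulr (baxter dy w) (summable_ray br _ x dx))).
rewrite (hsum_mull _ (summable_mull (baxter dy w) (summable_dray _ _ _ _))).
apply: eq_hsum => m; rewrite -[LHS]scalerAl -[RHS]scalerAr.
apply: (congr1 ( *:%R _)).
have px : omega x (x + x *+ m) = 0 by rewrite omega_addr omega_mulnr omegaxx.
rewrite (hP_baxter (phi := omega x) _ _ px xy (x0 m)).
rewrite /qray omega_addl omega_mulnl xy.
by have -> : 1 + 1 * m%:Z = m.+1%:Z by lia.
Qed.

(** Now the direction is x+y, and omega(x+y, (m+1)x) = -(m+1) explains the negative upper index. *)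
Lemma baxter_dlog : baxter dxy (v * w) * ray_dlog dx v =
  dray dx dxy a (fun m k => qbin br brV (- m.+1%:Z) k * (v * w) ^+ k)
  * baxter dxy (v * w).
Proof.
rewrite (hsum_mull _ (summable_mull (baxter dxy (v * w)) (summable_ray br _ x dx))).
rewrite [RHS](hsum_mulr _ (summable_mulr (baxter dxy (v * w)) (summable_dray _ _ _ _))).
apply: eq_hsum => m; rewrite -[LHS]scalerAr -[RHS]scalerAl.
apply: (congr1 ( *:%R _)).
have px : omega x (x + x *+ m) = 0 by rewrite omega_addr omega_mulnr omegaxx.
have pxy : omega x (x + y) = 1 by rewrite omega_addr omegaxx xy.
rewrite (baxter_hP (phi := omega x) _ _ px pxy (x0 m)).
rewrite /qray omega_addr omega_mulnr omega_addl omegaxx omegaC xy.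
by have -> : 0 + -1 + (0 + -1) * m%:Z = - m.+1%:Z by lia.
Qed.

(** The point (m+1)x + k(x+y) of N is (m+k+1)x + ky. So at (m+1)x + ky the right side meets N for k
    <= m and the diagonal ray of x+y for k = m+1, while [m+1, k] = 0 beyond. *)
Lemma dlog_split :
  ray_dlog dxy (v * w) +
  dray dx dxy a (fun m k => qbin br brV (- m.+1%:Z) k * (v * w) ^+ k) =
  dray dx dy a (fun m k => qbin br brV m.+1 k * w ^+ k).
Proof.
have xxy : omega x (x + y) = 1 by rewrite omega_addr omegaxx xy.
have repr m k : x + x *+ m + (x + y) *+ k = x + x *+ (m + k) + y *+ k.
  by rewrite mulrnDl mulrnDr !addrA.
have diag k : x + y + (x + y) *+ k = x + x *+ k + y *+ k.+1.
  by rewrite mulrnDl mulrS addrACA !addrA.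
set N := dray _ _ _ _; set M := dray _ _ _ _.
apply/hatP => l; rewrite hatD.
have [[m [k ->]]|nl] := pselect (exists m k, l = x + x *+ m + y *+ k); last first.
  have nl' m k : l <> x + x *+ m + y *+ k by move=> lE; apply: nl; exists m, k.
  have -> : ray_dlog dxy (v * w) l = 0 by apply: ray_out => k; rewrite diag.
  have -> : N l = 0 by apply: dray_out => m k; rewrite repr.
  by rewrite add0r; apply/esym/dray_out.
rewrite [RHS](dray_at _ _ _ _ xy).
have [km|mk|->] := ltngtP k m.+1.
- have -> : ray_dlog dxy (v * w) (x + x *+ m + y *+ k) = 0.
    by apply: ray_out => j; rewrite diag => /(lattice_inj xy); lia.
  (* The point belongs to the term m - k of [N], which takes over the name m. *)
  have {km} -> : m = (m - k + k)%N by lia.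
  move: (m - k)%N => {}m; rewrite add0r -repr (dray_at _ _ _ _ xxy).
  apply: (congr1 ( *:%R^~ _)); rewrite /a exprMn.
  have := qbin_neg_brV brE brVK m k; rewrite addSn => h.
  rewrite [RHS](_ : _ = - ((- v) ^+ (m + k).+1 * w ^+ k
    * (brV (m + k).+1 * qbin br brV (m + k).+1 k))); last by ring.
  (* The sign (-1)^k of the reflection cancels the one between (-v)^k and v^k. *)
  rewrite h -addSn exprD (exprNn v k).
  have := sqrr_sign S k; move: ((-1) ^+ k) (qbin _ _ _ _) => e q e2.
  by ring: e2.
- rewrite (qbin_small _ brE mk) mul0r mulr0 scale0r.
  have -> : ray_dlog dxy (v * w) (x + x *+ m + y *+ k) = 0.
    by apply: ray_out => j; rewrite diag => /(lattice_inj xy); lia.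
  rewrite add0r; apply: dray_out => i j; rewrite repr => /(lattice_inj xy).
  by lia.
have -> : N (x + x *+ m + y *+ m.+1) = 0.
  by apply: dray_out => i j; rewrite repr => /(lattice_inj xy); lia.
rewrite addr0 -diag [LHS]ray_at (qbin_nn brVK) mul1r /a.
by apply: (congr1 ( *:%R^~ _)); rewrite -mulNr exprMn; ring.
Qed.

Lemma pentagon : baxter dx v * baxter dy w =
  baxter dy w * baxter dxy (v * w) * baxter dx v.
Proof.
have := dlog_baxter; have := baxter_dlog; have := dlog_split.
set N := dray _ _ _ _; set M := dray _ _ _ _.
(* The functional omega(-, y) is 0 at y and 1 at x and x+y, so its Euler derivation annihilates
   Q_y. *)
have [phi px py] : exists2 phi : {additive Z2 -> int}, phi x = 1 & phi y = 0.
  by exists (omegar y); [exact: xy|exact: omegaxx].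
have pxy : phi (x + y) = 1 by rewrite (raddfD phi) px py addr0.
have Ex := euler_baxter phi dx v; have Ey := euler_baxter phi dy w.
have Exy := euler_baxter phi dxy (v * w).
have Bx : phi_ge phi 1 (baxter dx v - 1) by exact: phi_ge_baxterB1.
have Bxy : phi_ge phi 1 (baxter dxy (v * w) - 1) by exact: phi_ge_baxterB1.
have Cy : phi_ge phi 0 (baxter dy w).
  by apply: phi_ge_exp; apply: phi_ge_ray; rewrite py.
have Cx : phi_ge phi 0 (baxter dx v).
  by apply: phi_ge_exp; apply: phi_ge_ray; rewrite px.
move: Ex Ey Exy Bx Bxy Cx Cy; rewrite px py pxy scale0r mul0r !scale1r.
have : pos_degree (ray_dlog dx v) by exact: pos_degree_ray.
move: (baxter dx v) (baxter dy w) (baxter dxy (v * w)) => X Y Z.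
move: (ray_dlog dx v) (ray_dlog dxy (v * w)) => L K.
move=> pL EX EY EZ Bx Bxy Cx Cy LN ZL LY.
apply/eqP; rewrite -subr_eq0; apply/eqP.
apply: (euler_unique (phi := phi) (X := L) (Y := 0) intr_invertible pL pos_degree0).
- rewrite raddfB /= !eulerM EX EY EZ mulr0 addr0 mul0r add0r mulr0 addr0.
  (* Y (K Z + Z L) X = Y (K + N) Z X = Y M Z X = L Y Z X, by [ZL], [LN] and [LY]. *)
  have -> : Y * (K * Z) * X + Y * Z * (L * X) = L * (Y * Z * X).
    rewrite !mulrA LY -LN mulrDr mulrDl mulrDl.
    by rewrite -(mulrA Y Z L) ZL !mulrA.
  by rewrite [RHS]mulrBr [L * (X * Y)]mulrA.
apply: phi_ge1_neq0.
(* Modulo phi-degree 1 both X and Z are 1, so both products reduce to Y. *)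
have -> : X * Y - Y * Z * X = (X - 1) * Y - Y * ((Z - 1) * X + (X - 1)).
  by rewrite !mulrBl !mul1r addrA subrK mulrBr mulr1 mulrA opprB addrA subrK.
apply: phi_geB; first exact: phi_geM0 Bx Cy.
by apply: phi_ge0M Cy _; apply: phi_geD Bx; exact: phi_geM0 Bxy Cx.
Qed.

End Pentagon.
End Commutation.

(** * The scalars *)

Lemma tofrac_inj (R : idomainType) : injective (@tofrac R).
Proof.
by move=> p q /eqP; rewrite -subr_eq0 -rmorphB tofrac_eq0 subr_eq0 => /eqP.
Qed.

Section Scalars.
Variable Rr : realType.
Local Notation Ks := (Ks Rr).

Lemma Ks_neq0 : Ks != 0.
Proof. by rewrite tofrac_eq0 polyC_eq0 polyX_eq0. Qed.

(** The equality s^(k+1) = s^(-k-1) would give s^(2k+2) = 1, impossible for a polynomial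
    variable. *)
Lemma Kbr_neq0 k : Kbr Rr k.+1 != 0.
Proof.
rewrite /Kbr subr_eq0 -(inj_eq (mulIf (expfz_neq0 k.+1 Ks_neq0))).
rewrite -!expfzDr ?Ks_neq0 // addNr expr0z.
rewrite -PoszD -exprnP -rmorphXn -(rmorph1 (@tofrac _)) (inj_eq (@tofrac_inj _)).
rewrite -rmorphXn -(rmorph1 polyC) (inj_eq polyC_inj).
apply/eqP => /(congr1 (fun p : {poly _} => size p)).
by rewrite size_polyXn size_poly1.
Qed.

Fact Ksz_in_base (k : int) : base_pred (Ks ^ k).
Proof.
apply/asboolP; case: k => n; first by apply: in_base_X; exact: in_base_s.
by rewrite NegzE -exprnN -exprVn; apply: in_base_X; exact: in_base_sV.
Qed.

Definition sz (k : int) : scal Rr := of_base (exist _ (Ks ^ k) (Ksz_in_base k)).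

Lemma of_base1 : of_base 1 = 1 :> scal Rr.
Proof. by rewrite /of_base !rmorph1. Qed.

Lemma of_baseB a b : of_base (a - b) = of_base a - of_base b :> scal Rr.
Proof. by rewrite /of_base !rmorphB. Qed.

Lemma of_baseM a b : of_base (a * b) = of_base a * of_base b :> scal Rr.
Proof. by rewrite /of_base !rmorphM. Qed.

Lemma sz0 : sz 0 = 1.
Proof. by rewrite -of_base1; apply: (congr1 (@of_base Rr)); apply: val_inj. Qed.

Lemma szD : {morph sz : a b / a + b >-> a * b}.
Proof.
move=> a b; rewrite -of_baseM; apply: (congr1 (@of_base Rr)); apply: val_inj.
by rewrite rmorphM /= expfzDr ?Ks_neq0.
Qed.

Lemma brkE k : brk Rr k = sz k - sz (- k).
Proof.
rewrite -of_baseB; apply: (congr1 (@of_base Rr)); apply: val_inj.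
by rewrite rmorphB.
Qed.

Lemma brkVK (k : nat) : brkV Rr k.+1 * brk Rr k.+1 = 1.
Proof.
rewrite -of_base1 -of_baseM; apply: (congr1 (@of_base Rr)); apply: val_inj.
by rewrite rmorphM rmorph1 /= mulVf ?Kbr_neq0.
Qed.

Lemma scal_cstM a b : scal_cst a * scal_cst b = scal_cst (a * b) :> scal Rr.
Proof.
rewrite -of_baseM; apply: (congr1 (@of_base Rr)); apply: val_inj.
by rewrite rmorphM /= /Kcst !rmorphM.
Qed.

Lemma scal_cst1 : scal_cst 1 = 1 :> scal Rr.
Proof.
rewrite -of_base1; apply: (congr1 (@of_base Rr)); apply: val_inj.
by rewrite rmorph1 /= /Kcst !rmorph1.
Qed.

Lemma scal_cst_nat n : scal_cst n%:R = n%:R :> scal Rr.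
Proof.
rewrite -[RHS](rmorph_nat (polyC \o polyC) n).
apply: (congr1 (@of_base Rr)); apply: val_inj.
by rewrite rmorph_nat /= /Kcst !rmorph_nat.
Qed.

Lemma scal_cstM_nat a n : scal_cst a * n%:R = scal_cst (a * n%:R) :> scal Rr.
Proof.
exact: etrans (congr1 ( *%R (scal_cst a)) (esym (scal_cst_nat n))) (scal_cstM _ _).
Qed.

Lemma scal_cst_natV n : scal_cst n.+1%:R^-1 * n.+1%:R = 1 :> scal Rr.
Proof.
apply: etrans (scal_cstM_nat _ _) _.
by rewrite mulVf ?scal_cst1 // pnatr_eq0.
Qed.

Lemma scal_cst_fact0V : scal_cst 0`!%:R^-1 = 1 :> scal Rr.
Proof. by rewrite fact0 invr1 scal_cst1. Qed.

Lemma scal_cst_factV n :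
  scal_cst (n.+1)`!%:R^-1 * n.+1%:R = scal_cst n`!%:R^-1 :> scal Rr.
Proof.
apply: etrans (scal_cstM_nat _ _) _; apply: (congr1 (@scal_cst Rr)).
by rewrite factS natrM invfM mulrAC mulVf ?mul1r // pnatr_eq0.
Qed.

(** Only the index differs: (k+1)x on one side, x + kx on the other. *)
Lemma BaxterE (delta : {additive Z2 -> int}) x (dx : 0 < delta x) (t : scal Rr) :
  Baxter dx t = baxter (brk Rr) (brkV Rr) (fun n => scal_cst n`!%:R^-1)
    (fun n => scal_cst n%:R^-1) dx t.
Proof.
apply: eq_hsum => n; congr (_ *: _ ^+ n).
by apply: eq_hsum => k; rewrite mulrS.
Qed.

End Scalars.

Theorem theorem6p8 (Rr : realType) (delta : {additive Z2 -> int}) (x y : Z2)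
    (hx : primitive x) (hy : primitive y) (hxy : omega x y = 1)
    (dx : 0 < delta x) (dy : 0 < delta y) :
  Baxter dx (vind Rr) * Baxter dy (wind Rr) =
  Baxter dy (wind Rr) * Baxter (delta_gt0D dx dy) (vind Rr * wind Rr)
    * Baxter dx (vind Rr).
Proof.
rewrite !BaxterE.
exact: (pentagon (@sz0 Rr) (@szD Rr) (@brkE Rr) (@brkVK Rr)
  (@scal_cst_fact0V Rr) (@scal_cst_factV Rr) (@scal_cst_natV Rr) _ _ _ hxy).
Qed.
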